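(* Let $K$ be any real valued field and $0\neq f\in\mathfrak{m}\subseteq K\{x\}=K\{x_1,\dots,x_n\}$. 1. $f$ is finitely right determined if and only if $\mu(f)$ is finite. 2. $f$ is finitely contact determined if and only if $\tau(f)$ is finite.
   Context: A real valued field is a field $K$ with a map $|\ |:K\to\mathbb{R}_{\ge 0}$ satisfying $|a|=0\Leftrightarrow a=0$, $|ab|=|a||b|$, $|a+b|\le|a|+|b|$ (the trivial valuation is allowed; $K$ need not be complete). For $x=(x_1,\dots,x_n)$, $K\{x\}\subseteq K[[x]]$ is the ring of convergent power series: those $f=\sum_\alpha c_\alpha x^\alpha$ for which $\sum_\alpha|c_\alpha|\varepsilon^\alpha<\infty$ for some $\varepsilon\in(\mathbb{R}_{>0})^n$. $\mathfrak{m}=\langle x_1,\dots,x_n\rangle$ is its maximal ideal. $\operatorname{Aut}(K\{x\})$ is the group of automorphisms of $K\{x\}$ as a local $K$-algebra. $j(f)=\langle\frac{\partial f}{\partial x_1},\dots,\frac{\partial f}{\partial x_n}\rangle$; the Milnor number is $\mu(f)=\dim_K K\{x\}/j(f)$ and the Tjurina number is $\tau(f)=\dim_K K\{x\}/\langle f,j(f)\rangle$. $f,g\in K\{x\}$ are right equivalent if $f=\varphi(g)$ for some $\varphi\in\operatorname{Aut}(K\{x\})$, and contact equivalent if $f=u\cdot\varphi(g)$ for some $\varphi\in\operatorname{Aut}(K\{x\})$ and some unit $u\in K\{x\}^*$. For a positive integer $d$, $f$ is right (resp. contact) $d$-determined if $f$ is right (resp. contact) equivalent to every $g\in K\{x\}$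 with $f-g\in\mathfrak{m}^{d+1}$; $f$ is finitely right (resp. contact) determined if it is right (resp. contact) $d$-determined for some positive integer $d$. *)

(* Defs.v *)
From HB Require Import structures.
From mathcomp Require Import all_boot all_order all_algebra.
From mathcomp Require Import finmap mpoly.
From mathcomp Require Import boolp classical_sets functions cardinality fsbigop.
From mathcomp Require Import reals ereal esum.

Set Implicit Arguments.
Unset Strict Implicit.
Unset Printing Implicit Defensive.

Import Order.TTheory GRing.Theory Num.Theory.

Local Open Scope classical_set_scope.
Local Open Scope ring_scope.

Record absolute_value (R : realType) (K : fieldType) := AbsoluteValue {
  absv :> K -> R;
  absv_ge0 : forall a, 0 <= absv a;
  absv_eq0 : forall a, absv a = 0 <-> a = 0;
  absvM : forall a b, absv (a * b) = absv a * absv b;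
  absv_triangle : forall a b, absv (a + b) <= absv a + absv b
}.

Section AbsoluteValueTheory.
Context (R : realType) (K : fieldType) (v : absolute_value R K).

Lemma absv0 : v 0 = 0. Proof. exact/absv_eq0. Qed.

Lemma absv1 : v 1 = 1.
Proof.
have n0 : v 1 != 0 by apply/eqP => /absv_eq0/eqP; rewrite oner_eq0.
by apply: (mulfI n0); rewrite -absvM !mulr1.
Qed.

Lemma absvN a : v (- a) = v a.
Proof.
have N1 : v (-1) = 1.
  apply/eqP; rewrite -(@eqrXn2 _ 2) ?absv_ge0 //.
  by rewrite expr1n expr2 -absvM mulrNN mulr1 absv1.
by rewrite -mulN1r absvM N1 mul1r.
Qed.

Lemma absv_sum (I : Type) (r : seq I) (P : pred I) (F : I -> K) :
  v (\sum_(i <- r | P i) F i) <= \sum_(i <- r | P i) v (F i).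
Proof.
elim/big_ind2: _ => [|x a y b xa yb|//]; first by rewrite absv0.
by rewrite (le_trans (absv_triangle _ _ _)) // lerD.
Qed.

Lemma absv_mulrn a k : v (a *+ k) <= v a *+ k.
Proof.
elim: k => [|k IH]; first by rewrite !mulr0n absv0.
by rewrite !mulrS (le_trans (absv_triangle _ _ _)) // lerD2l.
Qed.

End AbsoluteValueTheory.

(* K[[x_1, ..., x_n]]; f a is the coefficient of the monomial x^a. *)
Record mfps (n : nat) (K : comNzRingType) := MFPS { mfps_coef : 'X_{1..n} -> K }.

Coercion mfps_coef : mfps >-> Funclass.
HB.instance Definition _ (n : nat) (K : comNzRingType) :=
  [isNew for @mfps_coef n K].
HB.instance Definition _ (n : nat) (K : comNzRingType) :=
  [Choice of mfps n K by <:].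

Notation "{ 'mfps' K [ n ] }" := (mfps n K)
  (at level 0, K, n at level 2, format "{ 'mfps'  K [ n ] }") : type_scope.

Section FormalPowerSeries.
Context (n : nat) (K : comNzRingType).
Implicit Types (f g h : {mfps K[n]}) (a b : 'X_{1..n}).

Lemma mfpsP f g : (forall a, f a = g a) -> f = g.
Proof. by case: f g => [f] [g] /= fg; congr MFPS; apply/funext. Qed.

Definition mfps_zero : {mfps K[n]} := MFPS (fun=> 0).
Definition mfps_opp f : {mfps K[n]} := MFPS (fun a => - f a).
Definition mfps_add f g : {mfps K[n]} := MFPS (fun a => f a + g a).
Definition mfps_one : {mfps K[n]} := MFPS (fun a => (a == 0%MM)%:R).
(* The degree bound on the pairs b only makes the index type finite. *)
Definition mfps_mul f g : {mfps K[n]} := MFPS (fun a =>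
  \sum_(b : 'X_{1..n < (mdeg a).+1, (mdeg a).+1} | a == (b.1 + b.2)%MM)
     f b.1 * g b.2).
Definition mfps_scale (c : K) f : {mfps K[n]} := MFPS (fun a => c * f a).

Fact mfps_addA : associative mfps_add.
Proof. by move=> f g h; apply: mfpsP => a; apply: addrA. Qed.
Fact mfps_addC : commutative mfps_add.
Proof. by move=> f g; apply: mfpsP => a; apply: addrC. Qed.
Fact mfps_add0 : left_id mfps_zero mfps_add.
Proof. by move=> f; apply: mfpsP => a; apply: add0r. Qed.
Fact mfps_addN : left_inverse mfps_zero mfps_opp mfps_add.
Proof. by move=> f; apply: mfpsP => a; apply: addNr. Qed.

HB.instance Definition _ := GRing.isZmodule.Build {mfps K[n]}
  mfps_addA mfps_addC mfps_add0 mfps_addN.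

(* The ring axioms are transferred from {mpoly K[n]} by truncation. *)
Definition mfps_trunc (d : nat) f : {mpoly K[n]} :=
  \sum_(a : 'X_{1..n < d}) f a *: 'X_[a].

Lemma mcoeff_trunc d f a : (mdeg a < d)%N -> (mfps_trunc d f)@_a = f a.
Proof. exact: mcoeff_mpoly. Qed.

Lemma mcoeff_mulE (p q p' q' : {mpoly K[n]}) a :
  (forall b, (mdeg b <= mdeg a)%N -> p@_b = p'@_b) ->
  (forall b, (mdeg b <= mdeg a)%N -> q@_b = q'@_b) ->
  (p * q)@_a = (p' * q')@_a.
Proof.
move=> pp qq; rewrite !mcoeffM; apply: eq_bigr => -[b c] _ /=.
by rewrite pp ?qq // -ltnS bmdeg.
Qed.

Lemma mfps_mulE d f g a : (mdeg a < d)%N ->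
  mfps_mul f g a = (mfps_trunc d f * mfps_trunc d g)@_a.
Proof.
move=> ad; rewrite mcoeffM; apply: eq_bigr => -[b c] _ /=.
by rewrite !mcoeff_trunc // (leq_trans _ ad) // bmdeg.
Qed.

Lemma mcoeff_trunc_mul d f g a : (mdeg a < d)%N ->
  (mfps_trunc d (mfps_mul f g))@_a = (mfps_trunc d f * mfps_trunc d g)@_a.
Proof. by move=> ad; rewrite mcoeff_trunc // (mfps_mulE _ _ ad). Qed.

Fact mfps_mulA : associative mfps_mul.
Proof.
move=> f g h; apply: mfpsP => a; rewrite !(mfps_mulE _ _ (ltnSn _)).
set d := (mdeg a).+1; transitivity
  (mfps_trunc d f * (mfps_trunc d g * mfps_trunc d h))@_a.
  by apply: mcoeff_mulE => // b ba; rewrite mcoeff_trunc_mul.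
by rewrite mulrA; apply: mcoeff_mulE => // b ba; rewrite mcoeff_trunc_mul.
Qed.

Fact mfps_mulC : commutative mfps_mul.
Proof.
by move=> f g; apply: mfpsP => a; rewrite !(mfps_mulE _ _ (ltnSn _)) mulrC.
Qed.

Fact mfps_mul1 : left_id mfps_one mfps_mul.
Proof.
move=> f; apply: mfpsP => a; rewrite !(mfps_mulE _ _ (ltnSn _)).
rewrite -[RHS](mcoeff_trunc _ (ltnSn _)) -[in RHS](mul1r (mfps_trunc _ _)).
apply: mcoeff_mulE => // b ba.
by rewrite mcoeff_trunc // mcoeff1.
Qed.

Fact mfps_mulDl : left_distributive mfps_mul +%R.
Proof.
move=> f g h; apply: mfpsP => a.
by rewrite /= -big_split; apply: eq_bigr => b _; rewrite /= mulrDl.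
Qed.

Fact mfps_one_neq0 : mfps_one != 0.
Proof.
by apply/eqP => /(congr1 (fun f => f 0%MM))/eqP; rewrite /= eqxx oner_eq0.
Qed.

HB.instance Definition _ := GRing.Zmodule_isComNzRing.Build {mfps K[n]}
  mfps_mulA mfps_mulC mfps_mul1 mfps_mulDl mfps_one_neq0.

Fact mfps_scaleA c d f : mfps_scale c (mfps_scale d f) = mfps_scale (c * d) f.
Proof. by apply: mfpsP => a; apply: mulrA. Qed.
Fact mfps_scale1 : left_id 1 mfps_scale.
Proof. by move=> f; apply: mfpsP => a; apply: mul1r. Qed.
Fact mfps_scaleDr : right_distributive mfps_scale +%R.
Proof. by move=> c f g; apply: mfpsP => a; apply: mulrDr. Qed.
Fact mfps_scaleDl f : {morph mfps_scale^~ f : c d / c + d}.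
Proof. by move=> c d; apply: mfpsP => a; apply: mulrDl. Qed.

HB.instance Definition _ := GRing.Zmodule_isLmodule.Build K {mfps K[n]}
  mfps_scaleA mfps_scale1 mfps_scaleDr mfps_scaleDl.

Fact mfps_scaleAl (c : K) f g : c *: (f * g) = (c *: f) * g.
Proof.
apply: mfpsP => a; rewrite /= mulr_sumr.
by apply: eq_bigr => b _; rewrite /= mulrA.
Qed.

HB.instance Definition _ := GRing.Lmodule_isLalgebra.Build K {mfps K[n]}
  mfps_scaleAl.

Fact mfps_scaleAr (c : K) f g : c *: (f * g) = f * (c *: g).
Proof. by rewrite mulrC mfps_scaleAl mulrC. Qed.

HB.instance Definition _ := GRing.Lalgebra_isAlgebra.Build K {mfps K[n]}
  mfps_scaleAr.

Definition mfps_var (i : 'I_n) : {mfps K[n]} :=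
  MFPS (fun a => (a == U_(i)%MM)%:R).

Definition mfps_deriv (i : 'I_n) f : {mfps K[n]} :=
  MFPS (fun a => f (a + U_(i))%MM *+ (a i).+1).

End FormalPowerSeries.

Section ConvergentPowerSeries.
Context (R : realType) (K : fieldType) (v : absolute_value R K) (n : nat).
Implicit Types (f g : {mfps K[n]}) (a b : 'X_{1..n}) (e : 'I_n -> R).

Definition mmonom e a : R := \prod_(i < n) e i ^+ a i.

Definition convergent : {pred {mfps K[n]}} := [pred f : {mfps K[n]} | `[<
  exists2 e : 'I_n -> R, (forall i, 0 < e i) &
    (\esum_(a in [set: 'X_{1..n}]) (v (f a) * mmonom e a)%:E < +oo)%E >]].

Lemma mmonom_ge0 e a : (forall i, 0 < e i) -> 0 <= mmonom e a.
Proof. by move=> e0; apply: prodr_ge0 => i _; rewrite exprn_ge0 // ltW. Qed.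

Lemma mmonomD e a b : mmonom e (a + b)%MM = mmonom e a * mmonom e b.
Proof.
by rewrite -big_split; apply: eq_bigr => i _; rewrite mnmDE exprD.
Qed.

Lemma le_mmonom e e' a : (forall i, 0 < e i) -> (forall i, e i <= e' i) ->
  mmonom e a <= mmonom e' a.
Proof.
move=> e0 ee'; apply: ler_prod => i _.
by rewrite exprn_ge0 ?(ltW (e0 i)) //= lerXn2r // nnegrE ltW // (lt_le_trans (e0 i)).
Qed.

Lemma le_sum_mdeg (F : 'X_{1..n} -> R) (s : seq 'X_{1..n}) d :
  (forall a, 0 <= F a) -> uniq s -> {in s, forall a, (mdeg a < d)%N} ->
  \sum_(a <- s) F a <= \sum_(a : 'X_{1..n < d}) F a.
Proof.
move=> F0 us sd.
have -> : \sum_(a <- s) F a = \sum_(a : 'X_{1..n < d} | bmnm a \in s) F a.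
  pose r := seq.filter (fun b : 'X_{1..n < d} => bmnm b \in s) (index_enum _).
  transitivity (\sum_(a <- map (@bmnm n d) r) F a); last first.
    by rewrite big_map big_filter.
  apply/perm_big/uniq_perm => //.
    by rewrite map_inj_uniq ?filter_uniq ?index_enum_uniq //; apply: val_inj.
  move=> a; apply/idP/mapP => [as_|[b]].
    by exists (BMultinom (sd _ as_)); rewrite // mem_filter mem_index_enum andbT.
  by rewrite mem_filter => /andP[bs _] ->.
rewrite [leRHS](bigID (fun a : 'X_{1..n < d} => bmnm a \in s)) /= lerDl.
exact: sumr_ge0.
Qed.

Definition bounded_at e f (M : R) := forall d : nat,
  \sum_(a : 'X_{1..n < d}) v (f a) * mmonom e a <= M.

Lemma convergentP f : reflect
  (exists2 e, (forall i, 0 < e i) & exists M, bounded_at e f M)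
  (f \in convergent).
Proof.
apply: (iffP (asboolP _)) => -[e e0].
  set F := fun a => _; move=> Foo; exists e => //.
  have F0 a : 0 <= v (f a) * mmonom e a by rewrite mulr_ge0 ?absv_ge0 ?mmonom_ge0.
  exists (fine (esum setT F)) => d.
  have Ffin : (esum setT F) \is a fin_num.
    by rewrite ge0_fin_numE // esum_ge0 // => a _; rewrite lee_fin.
  rewrite -lee_fin fineK // -sumEFin.
  pose X := [fset (bmnm a) | a : 'X_{1..n < d}]%fset.
  apply: esum_ge; exists [set` X].
    by split; [exact: finite_fset | ].
  rewrite fsbig_finite //= set_fsetK big_imfset /=; last first.
    by move=> a b _ _; apply: val_inj.
  by rewrite big_enum /=.
case=> M fM; exists e => //; apply: (@le_lt_trans _ _ M%:E); last exact: ltry.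
apply: ub_ereal_sup => _ [A [Afin _] <-].
rewrite fsbig_finite //= sumEFin lee_fin.
set s := fset_set A; pose d := (\max_(a <- s) mdeg a).+1.
apply: le_trans (fM d).
have sd a : a \in s -> (mdeg a < d)%N.
  by move=> as_; rewrite ltnS (leq_bigmax_seq (F := @mdeg n)).
apply: le_sum_mdeg => // [a|]; last exact: fset_uniq.
by rewrite mulr_ge0 ?absv_ge0 ?mmonom_ge0.
Qed.

Lemma bounded_at_ge0 e f M : bounded_at e f M -> 0 <= M.
Proof. by move/(_ 0%N); apply: le_trans; rewrite big1 // => -[]. Qed.

Lemma bounded_at_le e e' f M : (forall i, 0 < e i) ->
  (forall i, e i <= e' i) -> bounded_at e' f M -> bounded_at e f M.
Proof.
move=> e0 ee' fM d; apply: le_trans (fM d); apply: ler_sum => a _.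
by rewrite ler_wpM2l ?absv_ge0 ?le_mmonom.
Qed.

Lemma convergent2 f g : f \in convergent -> g \in convergent ->
  exists2 e, (forall i, 0 < e i) &
    exists M N, bounded_at e f M /\ bounded_at e g N.
Proof.
move=> /convergentP[e e0 [M fM]] /convergentP[e' e'0 [N gN]].
exists (fun i => Num.min (e i) (e' i)) => [i|]; first by rewrite lt_min e0 e'0.
have m0 i : 0 < Num.min (e i) (e' i) by rewrite lt_min e0 e'0.
exists M, N; split.
  by apply: bounded_at_le fM => // i; rewrite ge_min lexx.
by apply: bounded_at_le gN => // i; rewrite ge_min lexx orbT.
Qed.

Lemma finsupp_convergent f d : (forall a, (d <= mdeg a)%N -> f a = 0) ->
  f \in convergent.
Proof.
move=> f0; apply/convergentP; exists (fun=> 1) => //.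
exists (\sum_(a : 'X_{1..n < d}) v (f a) * mmonom (fun=> 1) a) => k.
rewrite (bigID (fun a : 'X_{1..n < k} => mdeg a < d)%N) /= addrC big1 ?add0r.
  rewrite -big_filter -(big_map (@bmnm n k) xpredT (fun a => v (f a) * mmonom (fun=> 1) a)).
  apply: le_sum_mdeg => [a||a /mapP[b]].
  - by rewrite mulr_ge0 ?absv_ge0 ?mmonom_ge0.
  - by rewrite map_inj_uniq ?filter_uniq ?index_enum_uniq //; apply: val_inj.
  - by rewrite mem_filter => /andP[bd _] ->.
by move=> a; rewrite -leqNgt => /f0 ->; rewrite absv0 mul0r.
Qed.

Fact convergent_subalg_closed : subalg_closed convergent.
Proof.
split.
- apply: (@finsupp_convergent _ 1) => a; rewrite lt0n mdeg_eq0 => /negbTE a0.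
  by change ((a == 0%MM)%:R = 0 :> K); rewrite a0.
- move=> c f g /convergent2/[apply] -[e e0 [M [N [fM gN]]]].
  apply/convergentP; exists e => //; exists (v c * M + N) => d.
  apply: (@le_trans _ _ (\sum_(a : 'X_{1..n < d})
      (v c * (v (f a) * mmonom e a) + v (g a) * mmonom e a))).
    apply: ler_sum => a _; rewrite mulrA -mulrDl ler_wpM2r ?mmonom_ge0 //.
    by rewrite (le_trans (absv_triangle _ _ _)) //= absvM.
  rewrite big_split -mulr_sumr lerD //=; last exact: gN.
  by apply: ler_wpM2l; [exact: absv_ge0 | exact: fM].
- move=> f g /convergent2/[apply] -[e e0 [M [N [fM gN]]]].
  apply/convergentP; exists e => //; exists (M * N) => d.
  pose F (a : 'X_{1..n}) := v (f a) * mmonom e a.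
  pose G (a : 'X_{1..n}) := v (g a) * mmonom e a.
  have F0 a : 0 <= F a by rewrite mulr_ge0 ?absv_ge0 ?mmonom_ge0.
  have G0 a : 0 <= G a by rewrite mulr_ge0 ?absv_ge0 ?mmonom_ge0.
  apply: (@le_trans _ _ (\sum_(a : 'X_{1..n < d})
      \sum_(b : 'X_{1..n < d, d} | bmnm a == (b.1 + b.2)%MM) F b.1 * G b.2)).
    apply: ler_sum => a _.
    have -> : (f * g) a = \sum_(b : 'X_{1..n < d, d} | bmnm a == (b.1 + b.2)%MM)
        f b.1 * g b.2.
      rewrite (mfps_mulE _ _ (bmdeg a)) -!/(mfps_trunc _ _).
      rewrite (mcoeff_poly_mul _ _ (bmdeg a)).
      by apply: eq_bigr => -[b c] _; rewrite /= !mcoeff_trunc ?bmdeg.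
    apply: le_trans (ler_wpM2r (mmonom_ge0 _ e0) (absv_sum _ _ _ _)) _.
    rewrite mulr_suml ler_sum // => -[b c] /eqP /= ->.
    by rewrite absvM mmonomD mulrACA.
  rewrite (exchange_big_dep xpredT) //=.
  apply: (@le_trans _ _ (\sum_(b : 'X_{1..n < d, d}) F b.1 * G b.2)).
    apply: ler_sum => -[b c] _ /=.
    case: (ltnP (mdeg (b + c)%MM) d) => [bcd|dbc].
      by rewrite (big_pred1 (BMultinom bcd)).
    rewrite big1; first exact: mulr_ge0.
    move=> a /eqP abc.
    by move: (bmdeg a); rewrite abc ltnNge dbc.
  rewrite -(pair_bigA _ (fun b c : 'X_{1..n < d} => F b * G c)) /=.
  under eq_bigr do rewrite -mulr_sumr.
  rewrite -mulr_suml ler_pM ?sumr_ge0 //; [exact: fM | exact: gN].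
Qed.

HB.instance Definition _ :=
  GRing.isSubalgClosed.Build K {mfps K[n]} convergent convergent_subalg_closed.

Lemma convergent_var i : mfps_var K i \in convergent.
Proof.
apply: (@finsupp_convergent _ 2) => a /=.
by case: (eqVneq a U_(i)%MM) => //= ->; rewrite mdeg1.
Qed.

Lemma convergent_deriv i f : f \in convergent -> mfps_deriv i f \in convergent.
Proof.
move=> /convergentP[e e0 [M fM]]; apply/convergentP.
pose e' j := if j == i then e i / 2%:R else e j.
have e'0 j : 0 < e' j by rewrite /e'; case: ifP => // _; rewrite divr_gt0.
exists e' => //; exists (M / e i) => d; apply: (@le_trans _ _
  (\sum_(a : 'X_{1..n < d})
     v (f (a + U_(i))%MM) * mmonom e (a + U_(i))%MM / e i)).
  apply: ler_sum => -[a _] _ /=.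
  apply: (@le_trans _ _ (v (f (a + U_(i))%MM) *+ (a i).+1 * mmonom e' a)).
    by rewrite ler_wpM2r ?mmonom_ge0 ?absv_mulrn.
  rewrite mulrnAl -mulrnAr -mulrA ler_wpM2l ?absv_ge0 // mmonomD -mulrA.
  have -> : mmonom e U_(i)%MM = e i.
    rewrite /mmonom (bigD1 i) //= mnm1E eqxx expr1 big1 ?mulr1 // => j ji.
    by rewrite mnm1E eq_sym (negbTE ji) expr0.
  rewrite divff ?mulr1 ?gt_eqF // /mmonom (bigD1 i) //= [leRHS](bigD1 i) //=.
  have -> : \prod_(j < n | j != i) e' j ^+ a j = \prod_(j < n | j != i) e j ^+ a j.
    by apply: eq_bigr => j /negbTE ji; rewrite /e' ji.
  rewrite -mulrnAl ler_wpM2r //.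
    by apply: prodr_ge0 => j _; rewrite exprn_ge0 // ltW.
  rewrite /e' eqxx expr_div_n -mulr_natr -mulrA ler_piMr ?exprn_ge0 ?(ltW (e0 i)) //.
  rewrite mulrC ler_pdivrMr ?exprn_gt0 // mul1r -natrX ler_nat.
  exact: ltn_expl.
rewrite -mulr_suml ler_wpM2r ?invr_ge0 ?(ltW (e0 i)) //.
apply: le_trans (fM d.+1).
rewrite -(big_map (fun a : 'X_{1..n < d} => (bmnm a + U_(i))%MM) xpredT
  (fun a => v (f a) * mmonom e a)).
apply: le_sum_mdeg => [a||a /mapP[b _ ->]].
- by rewrite mulr_ge0 ?absv_ge0 ?mmonom_ge0.
- rewrite map_inj_uniq ?index_enum_uniq // => b c /addIm; exact: val_inj.
- by rewrite mdegD mdeg1 addn1 ltnS bmdeg.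
Qed.

End ConvergentPowerSeries.

(* K{x_1, ..., x_n}; K is not assumed complete and v may be trivial. *)
Record cps (R : realType) (K : fieldType) (v : absolute_value R K) (n : nat) :=
  CPS { cps_val :> {mfps K[n]}; cps_valP : cps_val \in @convergent R K v n }.



HB.instance Definition _ R K v n := [isSub for @cps_val R K v n].
HB.instance Definition _ R K v n := [Choice of @cps R K v n by <:].
HB.instance Definition _ R K v n :=
  [SubChoice_isSubComNzRing of @cps R K v n by <:].
HB.instance Definition _ R K v n :=
  [SubZmodule_isSubLmodule of @cps R K v n by <:].
HB.instance Definition _ R K v n :=
  [SubNzRing_SubLmodule_isSubLalgebra of @cps R K v n by <:].
HB.instance Definition _ R K v n :=
  [SubLalgebra_isSubAlgebra of @cps R K v n by <:].

Section CpsUnits.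
Context (R : realType) (K : fieldType) (v : absolute_value R K) (n : nat).
Implicit Types f g : cps v n.

Definition cps_unit : pred (cps v n) := [pred f | `[< exists g, g * f = 1 >]].

Definition cps_inv f : cps v n :=
  if pselect (exists g, g * f = 1) is left gf1 then projT1 (cid gf1) else f.

Fact cps_mulVr : {in cps_unit, left_inverse 1 cps_inv *%R}.
Proof.
move=> f /asboolP fu; rewrite /cps_inv; case: pselect => // gf1.
by case: cid.
Qed.

Fact cps_unitPl f g : g * f = 1 -> cps_unit f.
Proof. by move=> gf1; apply/asboolP; exists g. Qed.

Fact cps_inv_out : {in [predC cps_unit], cps_inv =1 id}.
Proof.
move=> f /asboolPn fu; rewrite /cps_inv; case: pselect => // gf1.
Qed.

HB.instance Definition _ :=
  GRing.ComNzRing_hasMulInverse.Build (cps v n) cps_mulVr cps_unitPl cps_inv_out.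

Definition cps_var (i : 'I_n) : cps v n := CPS (convergent_var v i).

Definition cps_deriv (i : 'I_n) f : cps v n :=
  CPS (convergent_deriv i (cps_valP f)).

End CpsUnits.

Section Ideals.
Context (A : comNzRingType).

Definition ideal_gen (S : set A) : {pred A} := [pred x : A | `[<
  exists (k : nat) (a s : 'I_k -> A),
    (forall i, S (s i)) /\ x = \sum_i a i * s i >]].

Lemma ideal_genP S x : reflect (exists (k : nat) (a s : 'I_k -> A),
    (forall i, S (s i)) /\ x = \sum_i a i * s i) (x \in ideal_gen S).
Proof. exact: asboolP. Qed.

Lemma ideal_genM S a x : x \in ideal_gen S -> a * x \in ideal_gen S.
Proof.
move=> /ideal_genP[k [b [s [Ss ->]]]]; apply/ideal_genP.
exists k, (fun i => a * b i), s; split => //.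
by rewrite mulr_sumr; apply: eq_bigr => i _; rewrite mulrA.
Qed.

Fact ideal_gen_zmod_closed S : zmod_closed (ideal_gen S).
Proof.
split; first by apply/ideal_genP; exists 0%N, (fun=> 0), (fun=> 0);
  split => [[]|]; rewrite ?big_ord0.
move=> x y /ideal_genP[k [a [s [Ss ->]]]] /ideal_genP[l [b [t [St ->]]]].
apply/ideal_genP; exists (k + l)%N,
  (fun i : 'I_(k + l) => match fintype.split i with inl j => a j | inr j => - b j end),
  (fun i : 'I_(k + l) => match fintype.split i with inl j => s j | inr j => t j end).
split; first by move=> i; case: fintype.split.
rewrite big_split_ord /= -sumrN; congr (_ + _); apply: eq_bigr => i _.
  by case: split_ordP => j /eqP; rewrite ?eq_lshift ?eq_lrshift // => /eqP ->.
case: split_ordP => j /eqP; rewrite ?eq_rshift ?eq_rlshift // => /eqP ->.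
by rewrite mulNr.
Qed.

HB.instance Definition _ S :=
  GRing.isZmodClosed.Build A (ideal_gen S) (ideal_gen_zmod_closed S).

Definition ideal_exp (S : {pred A}) (d : nat) : {pred A} :=
  ideal_gen [set \prod_(i < d) a i | a in [set a : 'I_d -> A |
    forall i, a i \in S]].

End Ideals.

Section QuotientModule.
Context (K : comNzRingType) (A : comAlgType K) (S : set A).
Local Open Scope quotient_scope.

Local Notation Q := {ideal_quot (ideal_gen S)}.

Definition ideal_quot_scale (c : K) : Q -> Q := lift_op1 Q ( *:%R c).

Fact pi_ideal_quot_scale c : {morph \pi_Q : x / c *: x >-> ideal_quot_scale c x}.
Proof.
move=> x; unlock ideal_quot_scale; apply/eqP; rewrite -Quotient.idealrBE.
rewrite -scalerBr -mulr_algl ideal_genM //.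
by rewrite Quotient.idealrBE reprK.
Qed.
Canonical pi_ideal_quot_scale_morph c := PiMorph1 (pi_ideal_quot_scale c).

Fact ideal_quot_scaleA c d x :
  ideal_quot_scale c (ideal_quot_scale d x) = ideal_quot_scale (c * d) x.
Proof. by rewrite -[x]reprK !piE scalerA. Qed.

Fact ideal_quot_scale1 : left_id 1 ideal_quot_scale.
Proof. by move=> x; rewrite -[x]reprK !piE scale1r. Qed.

Fact ideal_quot_scaleDr : right_distributive ideal_quot_scale +%R.
Proof. by move=> c x y; rewrite -[x]reprK -[y]reprK !piE scalerDr. Qed.

Fact ideal_quot_scaleDl x : {morph ideal_quot_scale^~ x : c d / c + d}.
Proof. by move=> c d; rewrite -[x]reprK !piE scalerDl. Qed.

HB.instance Definition _ := GRing.Zmodule_isLmodule.Build K Q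
  ideal_quot_scaleA ideal_quot_scale1 ideal_quot_scaleDr ideal_quot_scaleDl.

End QuotientModule.

Section Dimension.
Context (R : realType) (K : fieldType) (V : lmodType K).

Definition is_basis (k : nat) (e : 'I_k -> V) :=
  (forall c : 'I_k -> K, \sum_i c i *: e i = 0 -> forall i, c i = 0) /\
  (forall x : V, exists c : 'I_k -> K, x = \sum_i c i *: e i).

(* All finite bases have the same size, so the infimum is over a set with at
   most one element; it is +oo when there is no finite basis. *)
Definition kdim : \bar R :=
  ereal_inf [set (k%:R)%:E | k in [set k : nat |
    exists e : 'I_k -> V, is_basis e]].

End Dimension.

Section Determinacy.
Context (R : realType) (K : fieldType) (v : absolute_value R K) (n : nat).
Implicit Types f g : cps v n.

Definition max_ideal : {pred cps v n} := ideal_gen (range (@cps_var R K v n)).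

Definition jacobian_gens f : set (cps v n) := range (fun i => cps_deriv i f).

Definition milnor f : \bar R :=
  kdim R {ideal_quot (ideal_gen (jacobian_gens f))}.

Definition tjurina f : \bar R :=
  kdim R {ideal_quot (ideal_gen (f |` jacobian_gens f))}.

(* Elements of Aut(K{x}): bijective local morphisms of K-algebras. *)
Definition local_aut (phi : {lrmorphism cps v n -> cps v n}) :=
  bijective phi /\ {homo phi : g / g \in max_ideal}.

Definition right_equivalent f g :=
  exists phi : {lrmorphism cps v n -> cps v n}, local_aut phi /\ f = phi g.

Definition contact_equivalent f g :=
  exists (u : cps v n) (phi : {lrmorphism cps v n -> cps v n}),
    [/\ u \is a GRing.unit, local_aut phi & f = u * phi g].

Definition right_determined (d : nat) f :=
  forall g, f - g \in ideal_exp max_ideal d.+1 -> right_equivalent f g.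

Definition contact_determined (d : nat) f :=
  forall g, f - g \in ideal_exp max_ideal d.+1 -> contact_equivalent f g.

Definition finitely_right_determined f :=
  exists2 d : nat, (0 < d)%N & right_determined d f.

Definition finitely_contact_determined f :=
  exists2 d : nat, (0 < d)%N & contact_determined d f.

End Determinacy.

(* Main.v *)
Require Import Defs.
From HB Require Import structures.
From mathcomp Require Import all_boot all_order all_algebra.
From mathcomp Require Import mpoly.
From mathcomp Require Import boolp classical_sets.
From mathcomp Require Import reals ereal.
From mathcomp Require Import ring lra.

(** Let [O] be the ring of convergent power series and [m] its maximal ideal.

    Finite codimension.  For any ideal [I] of [O], [O / I] is finite-dimensional
    if and only if [I] contains a power of [m]: in a finite-dimensional quotient
    the powers of [x_i] satisfy a linear relation, and a nonzero polynomial in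
    [x_i] is a power of [x_i] times a unit of [O]
    ([finite_codimension_order]).  So the theorem says that [f] is finitely
    determined if and only if [j(f)], respectively [<f, j(f)>], contains a power
    of [m].

    Determinacy implies finite codimension.  In positive characteristic an
    orbit need not have the expected tangent space, so one argues by comparison:
    every [f] is congruent modulo [m^(d+1)] to a polynomial [g] with isolated critical
    point, namely its truncation plus [\sum_i x_i^N] with [N] large and invertible
    in [K] ([isolated_perturbation]).  A [d]-determined [f] is equivalent to
    this [g], and by the chain rule a power of [m] inside [j(g)] is carried by the
    equivalence into [j(f)], respectively [<f, j(f)>] ([contains_order_transport]).

    Finite codimension implies determinacy.  Suppose that [m^k] lies in
    [<e f, j(f)>], where [e] is 0 for right and 1 for contact equivalence, and that
    [g - f] lies in [m^(2k+2)].  One looks for [w] and [y] of order [k + 2] with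
    [g = (1 + e w) f(x + y)].  By Taylor's formula this reads
    [e f w + \sum_i d_i f y_i = (g - f) - (terms quadratic in w, y)], and the right
    side has order at least [2k + 2].  Dividing by the generators, which costs [k]
    orders and can be done linearly with control of the norms
    ([bounded_ideal_section]), turns the equation into a fixed point problem
    ([solve_unit_and_coordinates]) for a map that is contracting for the [m]-adic
    topology and preserves a ball of weighted norm at small radius.  The iterates
    stabilise coefficient by coefficient, and the weighted norm bound passes to
    their formal limit because it only concerns finite partial sums
    ([formal_fixed_point]); in this way convergence is obtained without taking
    limits in [K].  The same principle gives the inverse function theorem
    [perturbed_aut], by which [x + y] defines an automorphism, and the inverses of
    series with nonzero constant term. *)

Set Implicit Arguments.
Unset Strict Implicit.
Unset Printing Implicit Defensive.

Import Order.TTheory GRing.Theory Num.Theory.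

Local Open Scope ring_scope.

(** * Formal power series: orders, monomials and substitution *)

Section Multinomials.
Context (n : nat).
Implicit Types a b : 'X_{1..n}.

Lemma mnm_pos b : (0 < mdeg b)%N -> exists i, (U_(i) <= b)%MM.
Proof.
rewrite lt0n mdeg_eq0 => b0.
case: (pickP (fun i => b i != 0%N)) => [i bi|b00]; last first.
  by case/eqP: b0; apply/mnmP => i; have /negbFE/eqP := b00 i; rewrite mnm0E.
exists i; apply/mnm_lepP => j; rewrite mnm1E.
by case: eqVneq => [<-|//]; rewrite lt0n.
Qed.

Lemma mnm_rec (P : 'X_{1..n} -> Prop) : P 0%MM ->
  (forall b i, P b -> P (U_(i) + b)%MM) -> forall b, P b.
Proof.
move=> P0 PS b; elim: {b}(mdeg b) {-2}b (erefl (mdeg b)) => [b /eqP|d IH b bd].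
  by rewrite mdeg_eq0 => /eqP ->.
have [|i ib] := @mnm_pos b; first by rewrite bd.
have bE : (U_(i) + (b - U_(i)))%MM = b by rewrite addmC submK.
rewrite -bE; apply/PS/IH; apply: succn_inj.
by rewrite -bd -[in RHS]bE mdegD mdeg1 add1n.
Qed.

Lemma mnm_sub_deg d a : (d <= mdeg a)%N -> exists2 b, (b <= a)%MM & mdeg b = d.
Proof.
elim: d => [|d IH] da.
  by exists 0%MM; rewrite ?mdeg0 //; apply/mnm_lepP => i; rewrite mnm0E.
have [b ba bd] := IH (ltnW da).
have abE : (a - b + b)%MM = a by rewrite submK.
have [|i ib] := @mnm_pos (a - b)%MM.
  have adE : mdeg a = (mdeg (a - b)%MM + d)%N by rewrite -{1}abE mdegD bd.
  by move: da; rewrite adE -[X in (X < _)%N]add0n ltn_add2r.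
exists (U_(i) + b)%MM; last by rewrite mdegD mdeg1 bd.
apply/mnm_lepP => j; rewrite -[in X in (_ <= X)%N]abE !mnmDE leq_add2r.
exact: (mnm_lepP ib).
Qed.

Lemma big_mdeg_widen (V : nmodType) (F : 'X_{1..n} -> V) d d' : (d <= d')%N ->
  (forall b, (d <= mdeg b)%N -> F b = 0) ->
  \sum_(b : 'X_{1..n < d'}) F b = \sum_(b : 'X_{1..n < d}) F b.
Proof.
move=> dd' F0; rewrite (bigID (fun b : 'X_{1..n < d'} => mdeg b < d)%N) /=.
rewrite [X in _ + X]big1 ?addr0; last by move=> b; rewrite -leqNgt => /F0.
rewrite -big_filter -(big_map (@bmnm n d') xpredT).
rewrite -[RHS](big_map (@bmnm n d) xpredT).
apply/perm_big/uniq_perm.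
- by rewrite map_inj_uniq ?filter_uniq ?index_enum_uniq //; apply: val_inj.
- by rewrite map_inj_uniq ?index_enum_uniq //; apply: val_inj.
move=> a; apply/mapP/mapP => -[b].
  by rewrite mem_filter => /andP[bd _] ->; exists (BMultinom bd); rewrite ?mem_index_enum.
move=> _ ->; exists (BMultinom (leq_trans (bmdeg b) dd')) => //.
by rewrite mem_filter mem_index_enum /= bmdeg.
Qed.

Lemma mmap1D (S : comNzRingType) (h : 'I_n -> S) a b :
  mmap1 h (a + b)%MM = mmap1 h a * mmap1 h b.
Proof. by rewrite commr_mmap1_M // => i x; apply: mulrC. Qed.

End Multinomials.

Section FormalSeries.
Context (n : nat) (K : comNzRingType).
Local Notation A := {mfps K[n]}.
Implicit Types (f g h : A) (a b : 'X_{1..n}).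

Lemma mfps_addE f g a : (f + g) a = f a + g a. Proof. by []. Qed.
Lemma mfps_oppE f a : (- f) a = - f a. Proof. by []. Qed.
Lemma mfps_subE f g a : (f - g) a = f a - g a. Proof. by []. Qed.
Lemma mfps_scaleE c f a : (c *: f) a = c * f a. Proof. by []. Qed.
Lemma mfps_zeroE a : (0 : A) a = 0. Proof. by []. Qed.
Lemma mfps_oneE a : (1 : A) a = (a == 0%MM)%:R. Proof. by []. Qed.
Lemma mfps_mulEpair f g a : (f * g) a =
  \sum_(b : 'X_{1..n < (mdeg a).+1, (mdeg a).+1} | a == (b.1 + b.2)%MM)
     f b.1 * g b.2.
Proof. by []. Qed.
Definition mfps_coefE :=
  (mfps_addE, mfps_oppE, mfps_scaleE, mfps_zeroE, mfps_oneE).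

Lemma mfps_sumE (I : Type) (r : seq I) (P : pred I) (F : I -> A) a :
  (\sum_(i <- r | P i) F i) a = \sum_(i <- r | P i) F i a.
Proof. by elim/big_rec2: _ => [|i x y _ <-]. Qed.

Definition xmon b : A := MFPS (fun a => (a == b)%:R).



Lemma xmonE b a : xmon b a = (a == b)%:R. Proof. by []. Qed.
Lemma xmon0 : xmon 0%MM = 1. Proof. by []. Qed.
Lemma xmon1 i : xmon U_(i)%MM = mfps_var K i. Proof. by []. Qed.

Lemma xmon_mulE b h a :
  (xmon b * h) a = if (b <= a)%MM then h (a - b)%MM else 0.
Proof.
rewrite mfps_mulEpair; case: ifP => [ba|nba]; last first.
  apply: big1 => -[c e] /eqP /= aE; rewrite ?xmonE.
  case: eqVneq => [cb|]; last by rewrite mul0r.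
  by case/negP: (negbT nba); rewrite aE cb lem_addr.
have lt1 : (mdeg b < (mdeg a).+1)%N.
  by rewrite ltnS -(submK ba) mdegD leq_addl.
have lt2 : (mdeg (a - b)%MM < (mdeg a).+1)%N by rewrite ltnS mdegB.
rewrite (bigD1 (BMultinom lt1, BMultinom lt2)) /=; last by rewrite addmC submK.
rewrite ?xmonE eqxx mul1r big1 ?addr0 // => -[c e] /andP[/eqP /= aE ce].
rewrite ?xmonE; case: eqVneq => [cb|]; last by rewrite mul0r.
case/eqP: ce; congr pair; apply: val_inj => //=.
by rewrite [in RHS]aE -cb addmC addmK.
Qed.

Lemma xmonD a b : xmon (a + b)%MM = xmon a * xmon b.
Proof.
apply: mfpsP => c; rewrite xmon_mulE !xmonE.
case: ifP => [ac|nac].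
  by rewrite -[in RHS](eqm_add2r a) submK // addmC.
by case: eqVneq => // cE; case/negP: (negbT nac); rewrite cE lem_addr.
Qed.

(** [f] lies in the [d]-th power of the maximal ideal of the formal ring. *)
Definition order_ge d f := forall a, (mdeg a < d)%N -> f a = 0.

Lemma order_ge_le d d' f : (d <= d')%N -> order_ge d' f -> order_ge d f.
Proof. by move=> dd' fd a ad; apply: fd; apply: leq_trans dd'. Qed.

Lemma order_geD d f g : order_ge d f -> order_ge d g -> order_ge d (f + g).
Proof. by move=> fd gd a ad; rewrite mfps_addE fd // gd // addr0. Qed.

Lemma order_geN d f : order_ge d f -> order_ge d (- f).
Proof. by move=> fd a ad; rewrite mfps_oppE fd // oppr0. Qed.

Lemma order_geB d f g : order_ge d f -> order_ge d g -> order_ge d (f - g).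
Proof. by move=> fd gd; apply/order_geD/order_geN. Qed.

Lemma order_ge_trans d g f h :
  order_ge d (f - g) -> order_ge d (g - h) -> order_ge d (f - h).
Proof. by move=> fg gh; rewrite -(subrK g f) -addrA; apply: order_geD. Qed.

Lemma order_ge_sym d f g : order_ge d (f - g) -> order_ge d (g - f).
Proof. by move=> fg; rewrite -opprB; apply: order_geN. Qed.

Lemma order_geZ d c f : order_ge d f -> order_ge d (c *: f).
Proof. by move=> fd a ad; rewrite mfps_scaleE fd // mulr0. Qed.

Lemma order_ge_sum d (I : Type) (r : seq I) (P : pred I) (F : I -> A) :
  (forall i, P i -> order_ge d (F i)) -> order_ge d (\sum_(i <- r | P i) F i).
Proof. by move=> Fd; elim/big_ind: _ => // f g; apply: order_geD. Qed.

Lemma order_geM d e f g : order_ge d f -> order_ge e g -> order_ge (d + e) (f * g).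
Proof.
move=> fd ge a ade; rewrite mfps_mulEpair big1 // => -[b c] /eqP /= aE.
have [bd|db] := ltnP (mdeg b) d; first by rewrite fd // mul0r.
rewrite ge ?mulr0 // -(ltn_add2l (mdeg b)) -mdegD -aE.
by apply: leq_trans ade _; rewrite leq_add2r.
Qed.

Lemma order_geMl d f g : order_ge d g -> order_ge d (f * g).
Proof. by move=> gd; rewrite -[d]add0n; apply: order_geM. Qed.

Lemma order_geMr d f g : order_ge d f -> order_ge d (f * g).
Proof. by move=> fd; rewrite mulrC; apply: order_geMl. Qed.

Lemma order_ge_xmon b : order_ge (mdeg b) (xmon b).
Proof. by move=> a ab; rewrite ?xmonE; case: eqVneq ab => // ->; rewrite ltnn. Qed.

Lemma order_ge_var i : order_ge 1 (mfps_var K i).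
Proof. by rewrite -xmon1 -(mdeg1 i); apply: order_ge_xmon. Qed.

Lemma order_ge_eq0 f : (forall d, order_ge d f) -> f = 0.
Proof. by move=> fd; apply: mfpsP => a; apply: (fd (mdeg a).+1). Qed.

Lemma order_ge_eq f g : (forall d, order_ge d (f - g)) -> f = g.
Proof. by move=> fg; apply/eqP; rewrite -subr_eq0; apply/eqP/order_ge_eq0. Qed.

Lemma order_ge_mmap1 (h : 'I_n -> A) b :
  (forall i, order_ge 1 (h i)) -> order_ge (mdeg b) (mmap1 h b).
Proof.
move=> h1; elim/mnm_rec: b => [|b i IH]; first by rewrite mdeg0.
by rewrite mdegD mdeg1 mmap1D mmap1U; apply: order_geM.
Qed.

Definition mfps_head d f : A := \sum_(b : 'X_{1..n < d}) f b *: xmon b.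

Lemma mfps_headE d f a : mfps_head d f a = if (mdeg a < d)%N then f a else 0.
Proof.
rewrite mfps_sumE; case: ifP => [ad|nad].
  rewrite (bigD1 (BMultinom ad)) // big1 => [|b ba].
    by rewrite /= addr0 eqxx mulr1.
  rewrite mfps_scaleE xmonE; case: eqVneq => [aE|_]; last by rewrite mulr0.
  by case/eqP: ba; apply: val_inj.
apply: big1 => b _; rewrite mfps_scaleE xmonE.
by case: eqVneq => [aE|_]; [move: nad; rewrite aE bmdeg | rewrite mulr0].
Qed.

Lemma order_ge_tail d f : order_ge d (f - mfps_head d f).
Proof. by move=> a ad; rewrite mfps_subE mfps_headE ad subrr. Qed.

(** [\sum_b f_b r_b] for a family [r] of series; the sum is locally finite as
    soon as [r b] has order at least [|b| - 1], which leaves room for the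
    derivatives of the monomials. *)
Definition lsum f (r : 'X_{1..n} -> A) : A :=
  MFPS (fun a => \sum_(b : 'X_{1..n < (mdeg a).+2}) f b * r b a).

Definition locally_finite (r : 'X_{1..n} -> A) :=
  forall b, order_ge (mdeg b).-1 (r b).

Section LocallyFiniteSums.
Implicit Types r : 'X_{1..n} -> A.

Lemma lsumE d f r a : locally_finite r -> ((mdeg a).+1 < d)%N ->
  lsum f r a = \sum_(b : 'X_{1..n < d}) f b * r b a.
Proof.
move=> rf ad; apply/esym/(big_mdeg_widen (F := fun b => f b * r b a) ad) => b.
by move=> ba; rewrite rf ?mulr0 //; case: (mdeg b) ba.
Qed.

Lemma order_ge_lsum d f r : (forall b, order_ge d (r b)) -> order_ge d (lsum f r).
Proof. by move=> rd a ad; apply: big1 => b _; rewrite rd // mulr0. Qed.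

Lemma lsumB f r r' : lsum f (fun b => r b - r' b) = lsum f r - lsum f r'.
Proof.
apply: mfpsP => a; rewrite mfps_subE -sumrB; apply: eq_bigr => b _.
by rewrite mfps_subE mulrBr.
Qed.

Lemma lsum_sum (I : finType) f (r : I -> 'X_{1..n} -> A) :
  lsum f (fun b => \sum_i r i b) = \sum_i lsum f (r i).
Proof.
apply: mfpsP => a; rewrite mfps_sumE exchange_big /=; apply: eq_bigr => b _.
by rewrite mfps_sumE mulr_sumr.
Qed.

Lemma lsum_mulr f r h : locally_finite r ->
  lsum f (fun b => r b * h) = lsum f r * h.
Proof.
move=> rf; apply: mfpsP => a; rewrite mfps_mulEpair.
under [RHS]eq_bigr => b /eqP ba.
  rewrite (@lsumE (mdeg a).+2) //; last by rewrite ltnS bmdeg.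
  rewrite mulr_suml; over.
rewrite exchange_big; apply: eq_bigr => b _; rewrite mfps_mulEpair mulr_sumr.
by apply: eq_bigr => c _; rewrite mulrA.
Qed.

Lemma lsum_linear r : linear (lsum^~ r).
Proof.
move=> c f g; apply: mfpsP => a; rewrite mfps_addE mfps_scaleE mulr_sumr -big_split.
by apply: eq_bigr => b _; rewrite !mfps_coefE /= mulrDl mulrA.
Qed.

Lemma lsum_xmon r b : locally_finite r -> lsum (xmon b) r = r b.
Proof.
move=> rf; apply: mfpsP => a.
have ad : ((mdeg a).+1 < ((mdeg a).+2 + mdeg b))%N by rewrite leq_addr.
have bd : (mdeg b < ((mdeg a).+2 + mdeg b))%N by rewrite -add1n leq_add2r.
rewrite (lsumE _ rf ad) (bigD1 (BMultinom bd)) //= ?xmonE eqxx mul1r big1 ?addr0 //.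
move=> c cb; rewrite ?xmonE; case: eqVneq => [cE|_]; last by rewrite mul0r.
by case/eqP: cb; apply: val_inj.
Qed.

Lemma lsum_id f : lsum f xmon = f.
Proof.
apply: mfpsP => a; have ad : (mdeg a < (mdeg a).+2)%N by rewrite ltnW.
rewrite /= (bigD1 (BMultinom ad)) //= ?xmonE eqxx mulr1 big1 ?addr0 //.
move=> c cb; rewrite ?xmonE; case: eqVneq => [cE|_]; last by rewrite mulr0.
by case/eqP: cb; apply: val_inj.
Qed.

End LocallyFiniteSums.

(** This is [f(h_1, ..., h_n)] only when the [h_i] have no constant term. *)
Definition mfps_subst f (h : 'I_n -> A) : A := lsum f (mmap1 h).

Section Substitution.
Context (h : 'I_n -> A) (h1 : forall i, order_ge 1 (h i)).

Lemma locally_finite_mmap1 : locally_finite (mmap1 h).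
Proof.
by move=> b; apply: order_ge_le (order_ge_mmap1 h1); apply: leq_pred.
Qed.

Lemma order_ge_subst d f : order_ge d f -> order_ge d (mfps_subst f h).
Proof.
move=> fd a ad; apply: big1 => b _.
have [bd|db] := ltnP (mdeg b) d; first by rewrite fd // mul0r.
by rewrite (order_ge_mmap1 h1) ?mulr0 //; apply: leq_trans ad db.
Qed.

Lemma mfps_subst_linear : linear (mfps_subst^~ h). Proof. exact: lsum_linear. Qed.

Lemma mfps_substB f g : mfps_subst (f - g) h = mfps_subst f h - mfps_subst g h.
Proof.
have := mfps_subst_linear (-1) g f.
by rewrite !scaleN1r (addrC (- g)) (addrC (- mfps_subst g h)) => ->.
Qed.

Lemma mfps_subst0 : mfps_subst 0 h = 0.
Proof. by have := mfps_substB 0 0; rewrite !subrr. Qed.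

Lemma mfps_substZ c f : mfps_subst (c *: f) h = c *: mfps_subst f h.
Proof. by rewrite -[c *: f]addr0 mfps_subst_linear mfps_subst0 addr0.
Qed.

Lemma mfps_subst_sum (I : Type) (r : seq I) (P : pred I) (F : I -> A) :
  mfps_subst (\sum_(i <- r | P i) F i) h = \sum_(i <- r | P i) mfps_subst (F i) h.
Proof.
elim/big_rec2: _ => [|i x y _ <-]; first exact: mfps_subst0.
by rewrite -[F i]scale1r mfps_subst_linear !scale1r.
Qed.

Lemma mfps_subst_xmon b : mfps_subst (xmon b) h = mmap1 h b.
Proof. exact/lsum_xmon/locally_finite_mmap1. Qed.

Lemma mfps_subst_var i : mfps_subst (mfps_var K i) h = h i.
Proof. by rewrite -xmon1 mfps_subst_xmon mmap1U. Qed.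

Lemma mfps_subst1 : mfps_subst 1 h = 1.
Proof. by rewrite -xmon0 mfps_subst_xmon mmap11. Qed.

(** Substitution is continuous for the order filtration, so both sides need only
    be compared on truncations of [f] and [g], hence on monomials. *)
Lemma mfps_substM f g : mfps_subst (f * g) h = mfps_subst f h * mfps_subst g h.
Proof.
apply: order_ge_eq => d.
set p := mfps_head d f; set q := mfps_head d g.
have pq : mfps_subst (p * q) h = mfps_subst p h * mfps_subst q h.
  rewrite big_distrlr /= !mfps_subst_sum big_distrlr /=; apply: eq_bigr => b _.
  rewrite mfps_subst_sum; apply: eq_bigr => c _.
  rewrite -scalerAl -scalerAr -xmonD !mfps_substZ !mfps_subst_xmon mmap1D.
  by rewrite -scalerAl -scalerAr.
have fp : order_ge d (f - p) := @order_ge_tail d f.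
have gq : order_ge d (g - q) := @order_ge_tail d g.
have split_prod (x y x' y' : A) : x * y - x' * y' = (x - x') * y + x' * (y - y').
  by rewrite mulrBl mulrBr addrA subrK.
have -> : mfps_subst (f * g) h - mfps_subst f h * mfps_subst g h =
    mfps_subst (f * g - p * q) h -
    (mfps_subst f h * mfps_subst g h - mfps_subst p h * mfps_subst q h).
  by rewrite mfps_substB pq opprB addrA subrK.
rewrite !split_prod -!mfps_substB; apply: order_geB.
  by apply/order_ge_subst/order_geD; [apply: order_geMr|apply: order_geMl].
by apply: order_geD; [apply: order_geMr|apply: order_geMl]; apply: order_ge_subst.
Qed.

End Substitution.

Section Derivatives.
Context (i : 'I_n).

Lemma mfps_derivE f a : mfps_deriv i f a = f (a + U_(i))%MM *+ (a i).+1.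
Proof. by []. Qed.

Lemma mfps_derivD f g : mfps_deriv i (f + g) = mfps_deriv i f + mfps_deriv i g.
Proof. by apply: mfpsP => a; rewrite !mfps_coefE !mfps_derivE -mulrnDl. Qed.

Lemma order_ge_deriv d f : order_ge d f -> order_ge d.-1 (mfps_deriv i f).
Proof.
move=> fd a ad; rewrite mfps_derivE fd ?mul0rn //.
by rewrite mdegD mdeg1 addn1; case: d ad {fd}.
Qed.

Lemma mfps_derivM f g :
  mfps_deriv i (f * g) = mfps_deriv i f * g + f * mfps_deriv i g.
Proof.
apply: mfpsP => a; rewrite mfps_addE mfps_derivE.
have tr h b : (mdeg b <= mdeg a)%N ->
    (mderiv i (mfps_trunc (mdeg a).+2 h))@_b = (mfps_trunc (mdeg a).+1 (mfps_deriv i h))@_b.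
  move=> ba; rewrite mcoeff_deriv !mcoeff_trunc //.
  by rewrite mdegD mdeg1 addn1 ltnS.
have tr' h b : (mdeg b <= mdeg a)%N ->
    (mfps_trunc (mdeg a).+2 h)@_b = (mfps_trunc (mdeg a).+1 h)@_b.
  by move=> ba; rewrite !mcoeff_trunc // ltnW.
have lt : (mdeg (a + U_(i))%MM < (mdeg a).+2)%N by rewrite mdegD mdeg1 addn1.
rewrite (mfps_mulE f g lt) -mcoeff_deriv mderivM mcoeffD.
rewrite (mfps_mulE _ g (ltnSn _)) (mfps_mulE f _ (ltnSn _)).
congr (_ + _); apply: mcoeff_mulE => b ba; rewrite ?tr ?tr' //.
Qed.

Lemma mfps_deriv_var j : mfps_deriv i (mfps_var K j) = (i == j)%:R.
Proof.
apply: mfpsP => a; rewrite mfps_derivE -xmon1 xmonE.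
have -> : ((i == j)%:R : A) a = (a == 0%MM)%:R *+ (i == j).
  by case: (i == j).
have [<-|ij] := eqVneq i j.
  rewrite -[X in _ == X]add0m eqm_add2r.
  by case: (eqVneq a 0%MM) => [->|_]; rewrite ?mul0rn // mnm0E.
case: (eqVneq (a + U_(i))%MM U_(j)%MM) => [/mnmP/(_ i)|_]; last by rewrite mul0rn.
by rewrite mnmDE !mnm1E eqxx eq_sym (negbTE ij) addn1.
Qed.

End Derivatives.

End FormalSeries.

(** * Weighted bounds and formal fixed points *)

Section Bounds.
Context (R : realType) (K : fieldType) (v : absolute_value R K) (n : nat).
Local Notation A := {mfps K[n]}.
Implicit Types (f g : A) (a b : 'X_{1..n}) (s r M N C : R).

(** The norm of [f] on the polydisc of radius [s] in every variable is at most
    [M]; partial sums are used because such bounds survive formal limits, and one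
    radius suffices because the radii of a polydisc can be shrunk to their
    minimum. *)
Definition bnd s f M := forall d : nat,
  \sum_(a : 'X_{1..n < d}) v (f a) * s ^+ mdeg a <= M.

Lemma mmonom_const s a : mmonom (fun=> s) a = s ^+ mdeg a.
Proof. by rewrite /mmonom prodrXr mdegE. Qed.

Lemma bnd_bounded_at s f M : bnd s f M <-> bounded_at v (fun=> s) f M.
Proof.
have E d : \sum_(a : 'X_{1..n < d}) v (f a) * mmonom (fun=> s) a =
    \sum_(a : 'X_{1..n < d}) v (f a) * s ^+ mdeg a.
  by apply: eq_bigr => a _; rewrite mmonom_const.
by split=> fM d; [rewrite E|rewrite -E].
Qed.

Lemma bnd_ge0 s f M : bnd s f M -> 0 <= M.
Proof. by move/(_ 0%N); apply: le_trans; rewrite big1 // => -[]. Qed.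

Lemma bnd_leM s f M N : M <= N -> bnd s f M -> bnd s f N.
Proof. by move=> MN fM d; apply: le_trans (fM d) MN. Qed.

Lemma bnd_le s r f M : 0 <= s -> s <= r -> bnd r f M -> bnd s f M.
Proof.
move=> s0 sr fM d; apply: le_trans (fM d); apply: ler_sum => a _.
by rewrite ler_wpM2l ?absv_ge0 // lerXn2r // nnegrE // (le_trans s0).
Qed.

Lemma bnd0 s : bnd s 0 0.
Proof. by move=> d; rewrite big1 // => a _; rewrite absv0 mul0r. Qed.

Lemma bndD s f g M N : 0 <= s -> bnd s f M -> bnd s g N -> bnd s (f + g) (M + N).
Proof.
move=> s0 fM gN d; apply: le_trans (lerD (fM d) (gN d)).
rewrite -big_split; apply: ler_sum => a _ /=.
by rewrite -mulrDl ler_wpM2r ?exprn_ge0 ?absv_triangle.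
Qed.

Lemma bndN s f M : bnd s f M -> bnd s (- f) M.
Proof.
move=> fM d; apply: le_trans (fM d); apply: ler_sum => a _.
by rewrite mfps_oppE absvN.
Qed.

Lemma bndB s f g M N : 0 <= s -> bnd s f M -> bnd s g N -> bnd s (f - g) (M + N).
Proof. by move=> s0 fM gN; apply/bndD/bndN. Qed.

Lemma bnd_sum s (I : Type) (t : seq I) (P : pred I) (F : I -> A) (M : I -> R) :
  0 <= s -> (forall i, P i -> bnd s (F i) (M i)) ->
  bnd s (\sum_(i <- t | P i) F i) (\sum_(i <- t | P i) M i).
Proof.
move=> s0 FM; elim/big_ind2: _ => [|f M1 g M2|//]; first exact: bnd0.
exact: bndD.
Qed.

Lemma bndM s f g M N : 0 <= s -> bnd s f M -> bnd s g N -> bnd s (f * g) (M * N).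
Proof.
move=> s0 fM gN d.
pose F a := v (f a) * s ^+ mdeg a; pose G a := v (g a) * s ^+ mdeg a.
have F0 a : 0 <= F a by rewrite mulr_ge0 ?absv_ge0 ?exprn_ge0.
have G0 a : 0 <= G a by rewrite mulr_ge0 ?absv_ge0 ?exprn_ge0.
apply: (@le_trans _ _ (\sum_(a : 'X_{1..n < d})
    \sum_(b : 'X_{1..n < d, d} | bmnm a == (b.1 + b.2)%MM) F b.1 * G b.2)).
  apply: ler_sum => a _.
  have -> : (f * g) a = \sum_(b : 'X_{1..n < d, d} | bmnm a == (b.1 + b.2)%MM)
      f b.1 * g b.2.
    rewrite (mfps_mulE _ _ (bmdeg a)) (mcoeff_poly_mul _ _ (bmdeg a)).
    by apply: eq_bigr => -[b c] _; rewrite /= !mcoeff_trunc ?bmdeg.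
  apply: le_trans (ler_wpM2r (exprn_ge0 _ s0) (absv_sum _ _ _ _)) _.
  rewrite mulr_suml ler_sum // => -[b c] /eqP /= ->.
  by rewrite absvM mdegD exprD mulrACA.
rewrite (exchange_big_dep xpredT) //=.
apply: (@le_trans _ _ (\sum_(b : 'X_{1..n < d, d}) F b.1 * G b.2)).
  apply: ler_sum => -[b c] _ /=.
  case: (ltnP (mdeg (b + c)%MM) d) => [bcd|dbc].
    by rewrite (big_pred1 (BMultinom bcd)).
  rewrite big1; first exact: mulr_ge0.
  by move=> a /eqP abc; move: (bmdeg a); rewrite abc ltnNge dbc.
rewrite -(pair_bigA _ (fun b c : 'X_{1..n < d} => F b * G c)) /=.
under eq_bigr do rewrite -mulr_sumr.
rewrite -mulr_suml ler_pM ?sumr_ge0 //; [exact: fM | exact: gN].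
Qed.

Lemma bnd_xmon s b : 0 <= s -> bnd s (xmon K b) (s ^+ mdeg b).
Proof.
move=> s0 d; have [bd|db] := ltnP (mdeg b) d; last first.
  rewrite big1 ?exprn_ge0 // => a _; rewrite xmonE; case: eqVneq => [ab|_].
    by move: (bmdeg a); rewrite ab ltnNge db.
  by rewrite absv0 mul0r.
rewrite (bigD1 (BMultinom bd)) //= eqxx absv1 mul1r big1 ?addr0 // => a ab.
case: eqVneq => [aE|_]; last by rewrite absv0 mul0r.
by case/eqP: ab; apply: val_inj.
Qed.

Lemma bnd_var s i : 0 <= s -> bnd s (mfps_var K i) s.
Proof.
by move=> s0; have := bnd_xmon U_(i)%MM s0; rewrite xmon1 mdeg1 expr1.
Qed.

Lemma bnd1 s : 0 <= s -> bnd s 1 1.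
Proof. by move=> s0; have := bnd_xmon 0%MM s0; rewrite xmon0 mdeg0 expr0. Qed.

Lemma bnd_mmap1 s r (h : 'I_n -> A) b : 0 <= s ->
  (forall i, bnd s (h i) r) -> bnd s (mmap1 h b) (r ^+ mdeg b).
Proof.
move=> s0 hr; elim/mnm_rec: b => [|b i IH].
  by rewrite mmap11 mdeg0 expr0; apply: bnd1.
by rewrite mdegD mdeg1 exprS mmap1D mmap1U; apply: bndM.
Qed.

Lemma bnd_lsum s r C M f (t : 'X_{1..n} -> A) : 0 <= s -> 0 <= r -> 0 <= C ->
  locally_finite t -> (forall b, bnd s (t b) (C * r ^+ mdeg b)) ->
  bnd r f M -> bnd s (lsum f t) (C * M).
Proof.
move=> s0 r0 C0 tf tC fM d.
apply: (@le_trans _ _ (\sum_(b : 'X_{1..n < d.+1}) v (f b) *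
    \sum_(a : 'X_{1..n < d}) v (t b a) * s ^+ mdeg a)).
  under [leRHS]eq_bigr do rewrite mulr_sumr.
  rewrite exchange_big; apply: ler_sum => a _.
  have ad : ((mdeg a).+1 < d.+1)%N by rewrite ltnS bmdeg.
  rewrite (lsumE _ tf ad).
  apply: le_trans (ler_wpM2r (exprn_ge0 _ s0) (absv_sum _ _ _ _)) _.
  by rewrite mulr_suml; apply: ler_sum => b _; rewrite absvM mulrA.
apply: (@le_trans _ _ (\sum_(b : 'X_{1..n < d.+1}) v (f b) * (C * r ^+ mdeg b))).
  by apply: ler_sum => b _; rewrite ler_wpM2l ?absv_ge0 // tC.
under eq_bigr do rewrite mulrCA.
by rewrite -mulr_sumr ler_wpM2l // fM.
Qed.

Lemma bnd_subst s r M f (h : 'I_n -> A) : 0 <= s -> 0 <= r ->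
  (forall i, order_ge 1 (h i)) -> (forall i, bnd s (h i) r) ->
  bnd r f M -> bnd s (mfps_subst f h) M.
Proof.
move=> s0 r0 h1 hr fM; rewrite -[M]mul1r.
apply: (bnd_lsum s0 r0) fM => // [|b]; first exact: locally_finite_mmap1.
by rewrite mul1r; apply: bnd_mmap1.
Qed.

(** This gain of the [d]-th power of [s / r] at small radius [s] is what makes the
    maps iterated below preserve small balls. *)
Lemma bnd_order s r d f M : 0 < s -> s <= r -> order_ge d f -> bnd r f M ->
  bnd s f ((s / r) ^+ d * M).
Proof.
move=> s0 sr fd fM e; have r0 : 0 < r by apply: lt_le_trans sr.
apply: le_trans (ler_wpM2l _ (fM e)); last first.
  by rewrite exprn_ge0 // divr_ge0 // ltW.
rewrite mulr_sumr; apply: ler_sum => a _.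
have [ad|da] := ltnP (mdeg a) d; first by rewrite fd // absv0 !mul0r mulr0.
rewrite mulrCA ler_wpM2l ?absv_ge0 //.
have -> : s ^+ mdeg a = (s / r) ^+ mdeg a * r ^+ mdeg a.
  by rewrite -exprMn divfK // gt_eqF.
rewrite ler_wpM2r ?exprn_ge0 ?(ltW r0) //.
apply: ler_wiXn2l => //; first by rewrite divr_ge0 // ltW.
by rewrite ler_pdivrMr // mul1r.
Qed.

Lemma bnd_limit s f M :
  (forall d, exists2 g, bnd s g M & order_ge d (f - g)) -> bnd s f M.
Proof.
move=> fM d; have [g gM fg] := fM d; apply: le_trans (gM d); rewrite le_eqVlt.
apply/orP; left; apply/eqP/eq_bigr => a _; congr (v _ * _).
by apply/eqP; rewrite -subr_eq0 -mfps_subE fg ?bmdeg.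
Qed.

Lemma convergent_bnd f : reflect (exists2 r, 0 < r & exists M, bnd r f M)
  (f \in convergent v (n := n)).
Proof.
apply: (iffP (convergentP _ _)) => [[e e0 [M fM]]|[r r0 [M fM]]]; last first.
  by exists (fun=> r) => //; exists M; apply/bnd_bounded_at.
pose r := \big[Num.min/1]_i e i.
have [r0 re] : 0 < r /\ forall i, r <= e i.
  split; first by apply/bigmin_gtP; split.
  by move=> i; apply: bigmin_le.
by exists r => //; exists M; apply/bnd_bounded_at/bounded_at_le/fM.
Qed.

Lemma convergent_bnd_fin (I : finType) (F : I -> A) :
  (forall i, F i \in convergent v (n := n)) ->
  exists2 r, 0 < r & exists2 M, 0 < M & forall i, bnd r (F i) M.
Proof.
move=> Fc; have rM i : exists rM : R * R, 0 < rM.1 /\ bnd rM.1 (F i) rM.2.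
  by have /convergent_bnd[r r0 [M FM]] := Fc i; exists (r, M).
pose rr i := (projT1 (cid (rM i))).1; pose MM i := (projT1 (cid (rM i))).2.
have rr0 i : 0 < rr i by rewrite /rr; case: cid => x [].
have FM i : bnd (rr i) (F i) (MM i) by rewrite /rr /MM; case: cid => x [].
exists (\big[Num.min/1]_i rr i).
  by apply/bigmin_gtP; split.
exists (1 + \sum_i MM i) => [|i].
  by rewrite ltr_pwDl // sumr_ge0 // => i _; apply: bnd_ge0 (FM i).
apply: bnd_leM (bnd_le _ _ (FM i)).
- rewrite (bigD1 i) //= addrCA lerDl addr_ge0 // sumr_ge0 // => j _.
  exact: bnd_ge0 (FM j).
- by apply: ltW; apply/bigmin_gtP; split.
- exact: bigmin_le.
Qed.

Section FixedPoint.
Context (I : Type) (k : nat) (s rho : R) (T : (I -> A) -> I -> A).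

Definition in_ball (z : I -> A) :=
  forall i, order_ge k (z i) /\ bnd s (z i) rho.

(** Iterates of [T] from [0] stabilise coefficientwise, so the fixed point is a
    formal limit; the weighted bounds are suprema of finite sums and survive
    this limit.  No limit is taken in [K], which is how convergent solutions are
    obtained over incomplete fields. *)
Lemma formal_fixed_point : 0 <= rho ->
  (forall z, in_ball z -> in_ball (T z)) ->
  (forall d z z', in_ball z -> in_ball z' ->
     (forall i, order_ge d (z i - z' i)) ->
     forall i, order_ge d.+1 (T z i - T z' i)) ->
  exists2 z, in_ball z & forall i, T z i = z i.
Proof.
move=> rho0 TB Tc; pose Z t := iter t T (fun=> 0).
have ZB t : in_ball (Z t).
  elim: t => [|t IH]; last exact: TB.
  by move=> i; split=> //; apply: bnd_leM rho0 (bnd0 s).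
have ZS t i : order_ge t (Z t.+1 i - Z t i).
  by elim: t i => [//|t IH] i; apply: (Tc t (Z t.+1) (Z t)).
have ZD t u i : order_ge t (Z (u + t)%N i - Z t i).
  elim: u => [|u IH]; first by rewrite subrr.
  by apply: order_ge_trans IH; apply: order_ge_le (ZS _ i); apply: leq_addl.
pose z i : A := MFPS (fun a => Z (mdeg a).+1 i a).
have zZ t i : order_ge t (z i - Z t i).
  move=> a at_; have := order_ge_sym (ZD (mdeg a).+1 (t - (mdeg a).+1)%N i).
  by rewrite subnK // => /(_ a (ltnSn _)) E; rewrite -[RHS]E.
have zB : in_ball z.
  move=> i; split.
    by rewrite -(subrK (Z k i) (z i)); apply: order_geD (ZB k i).1; apply: zZ.
  by apply: bnd_limit => d; exists (Z d i); [exact: (ZB d i).2|exact: zZ].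
exists z => // i; apply: order_ge_eq => d; apply: (@order_ge_le _ _ _ d.+1) => //.
apply: (@order_ge_trans _ _ _ (Z d.+1 i)); last exact/order_ge_sym/zZ.
by apply: (Tc d z (Z d)) => // j; apply: zZ.
Qed.

End FixedPoint.

End Bounds.

(** * Division by monomials with convergent quotients *)

Section MonomialDivision.
Context (n : nat) (K : fieldType).
Local Notation A := {mfps K[n]}.
Implicit Types (h : A) (a c : 'X_{1..n}).

(** A divisor of degree [d] of [x^a], chosen once and for all so that a series
    can be split as a sum of multiples of the monomials of degree [d] linearly
    and without increasing any coefficient. *)
Definition mnm_divisor d a : option 'X_{1..n < d.+1} :=
  [pick b : 'X_{1..n < d.+1} | (mdeg b == d) && (b <= a)%MM].

Definition mfps_quo d (b : 'X_{1..n < d.+1}) h : A :=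
  MFPS (fun c => if mnm_divisor d (c + b)%MM == Some b then h (c + b)%MM else 0).

Lemma mfps_quoE d (b : 'X_{1..n < d.+1}) h c : mfps_quo b h c =
  if mnm_divisor d (c + b)%MM == Some b then h (c + b)%MM else 0.
Proof. by []. Qed.

Lemma mfps_quo_sum d h : order_ge d h ->
  h = \sum_(b : 'X_{1..n < d.+1} | mdeg b == d) xmon K b * mfps_quo b h.
Proof.
move=> hd; apply: mfpsP => a; rewrite mfps_sumE.
under eq_bigr do rewrite xmon_mulE.
have [ad|da] := ltnP (mdeg a) d.
  rewrite hd // big1 // => b /eqP bd; case: ifP => // ba.
  by move: ad; rewrite -(submK ba) mdegD bd ltnNge leq_addl.
case E : (mnm_divisor d a) => [b0|]; last first.
  have [b ba bd] := mnm_sub_deg da; have bd1 : (mdeg b < d.+1)%N by rewrite bd.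
  move: E; rewrite /mnm_divisor; case: pickP => // /(_ (BMultinom bd1)).
  by rewrite /= bd eqxx ba.
have /andP[b0d b0a] : (mdeg b0 == d) && (b0 <= a)%MM.
  by move: E; rewrite /mnm_divisor; case: pickP => // b + [<-].
rewrite (bigD1 b0) //= b0a submK // E eqxx big1 ?addr0 // => b /andP[bd bb0].
case: ifP => // ba; rewrite submK // E; case: eqP => // -[] bE.
by rewrite bE eqxx in bb0.
Qed.

Lemma mfps_quoB d (b : 'X_{1..n < d.+1}) h h' :
  mfps_quo b (h - h') = mfps_quo b h - mfps_quo b h'.
Proof.
apply: mfpsP => c; rewrite mfps_subE !mfps_quoE mfps_subE.
by case: ifP => // _; rewrite subr0.
Qed.

Lemma order_ge_quo d t (b : 'X_{1..n < d.+1}) h : mdeg b = d ->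
  order_ge (d + t) h -> order_ge t (mfps_quo b h).
Proof.
move=> bd ht c ct; rewrite mfps_quoE; case: ifP => // _.
by apply: ht; rewrite mdegD bd addnC ltn_add2l.
Qed.

Context (R : realType) (v : absolute_value R K).

Lemma bnd_quo s M d (b : 'X_{1..n < d.+1}) h : 0 < s -> mdeg b = d ->
  bnd v s h M -> bnd v s (mfps_quo b h) (M / s ^+ d).
Proof.
move=> s0 bd hM e; rewrite ler_pdivlMr ?exprn_gt0 // mulr_suml.
apply: le_trans (hM (e + d)%N).
apply: (@le_trans _ _ (\sum_(c : 'X_{1..n < e})
    v (h (c + b)%MM) * s ^+ mdeg (c + b)%MM)).
  apply: ler_sum => c _; rewrite mdegD exprD bd mulrA.
  rewrite !ler_wpM2r ?exprn_ge0 ?(ltW s0) // mfps_quoE.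
  by case: ifP => // _; rewrite absv0 absv_ge0.
rewrite -(big_map (fun c : 'X_{1..n < e} => (bmnm c + b)%MM) xpredT
  (fun a => v (h a) * s ^+ mdeg a)).
apply: le_sum_mdeg => [a||a /mapP[c _ ->]].
- by rewrite mulr_ge0 ?absv_ge0 ?exprn_ge0 // ltW.
- rewrite map_inj_uniq ?index_enum_uniq // => c c' /addIm; exact: val_inj.
- by rewrite mdegD bd ltn_add2r bmdeg.
Qed.

Lemma convergent_quo d (b : 'X_{1..n < d.+1}) h : mdeg b = d ->
  h \in convergent v (n := n) -> mfps_quo b h \in convergent v (n := n).
Proof.
move=> bd /convergent_bnd[r r0 [M hM]]; apply/convergent_bnd.
by exists r => //; exists (M / r ^+ d); apply: bnd_quo.
Qed.

End MonomialDivision.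

(** * The local algebra of convergent power series *)

Section ConvergentAlgebra.
Context (R : realType) (K : fieldType) (v : absolute_value R K) (n : nat).
Local Notation A := {mfps K[n]}.
Local Notation O := (cps v n).
Implicit Types (f g h : O) (a b : 'X_{1..n}).

Lemma cps_addE f g : cps_val (f + g) = cps_val f + cps_val g. Proof. by []. Qed.
Lemma cps_subE f g : cps_val (f - g) = cps_val f - cps_val g. Proof. by []. Qed.
Lemma cps_mulE f g : cps_val (f * g) = cps_val f * cps_val g. Proof. by []. Qed.
Lemma cps_scaleE c f : cps_val (c *: f) = c *: cps_val f. Proof. by []. Qed.
Lemma cps_oneE : cps_val (1 : O) = 1. Proof. by []. Qed.
Lemma cps_inj f g : cps_val f = cps_val g -> f = g. Proof. exact: val_inj. Qed.

Lemma cps_sumE (I : Type) (r : seq I) (P : pred I) (F : I -> O) :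
  cps_val (\sum_(i <- r | P i) F i) = \sum_(i <- r | P i) cps_val (F i).
Proof. by elim/big_rec2: _ => [|i x y _ <-]. Qed.

Lemma convergent_xmon b : xmon K b \in convergent v (n := n).
Proof.
apply: (@finsupp_convergent _ _ _ _ _ (mdeg b).+1) => a ba; rewrite xmonE.
by case: eqVneq ba => // ->; rewrite ltnn.
Qed.

Definition cps_mon b : O := CPS (convergent_xmon b).

Lemma cps_mon0 : cps_mon 0%MM = 1. Proof. exact: cps_inj. Qed.

Lemma cps_mon1 i : cps_mon U_(i)%MM = cps_var v i. Proof. exact: cps_inj. Qed.

Lemma cps_monD a b : cps_mon (a + b)%MM = cps_mon a * cps_mon b.
Proof. exact/cps_inj/xmonD. Qed.

Lemma cps_mon_prod b : exists2 s : seq 'I_n, size s = mdeg b &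
  cps_mon b = \prod_(i <- s) cps_var v i.
Proof.
elim/mnm_rec: b => [|b i [s ss bE]].
  by exists [::]; rewrite ?big_nil ?mdeg0 ?cps_mon0.
exists (i :: s); first by rewrite mdegD mdeg1 add1n /= ss.
by rewrite big_cons cps_monD cps_mon1 bE.
Qed.

(** The quotients are convergent because dividing by the monomials of degree [d]
    only selects and shifts coefficients. *)
Lemma cps_quo_sum d f : order_ge d (cps_val f) -> exists g : 'X_{1..n < d.+1} -> O,
  f = \sum_(b : 'X_{1..n < d.+1} | mdeg b == d) cps_mon b * g b.
Proof.
move=> fd.
have gP (b : 'X_{1..n < d.+1}) : exists gb : O,
    mdeg b == d -> cps_val gb = mfps_quo b (cps_val f).
  have [bd|_] := eqVneq (mdeg b) d; last by exists 0.
  by exists (CPS (convergent_quo bd (cps_valP f))).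
exists (fun b : 'X_{1..n < d.+1} => projT1 (cid (gP b))).
apply: cps_inj; rewrite cps_sumE {1}(mfps_quo_sum fd); apply: eq_bigr => b bd.
by rewrite cps_mulE; case: cid => gb /= ->.
Qed.

Lemma max_ideal_order f : f \in @max_ideal R K v n -> order_ge 1 (cps_val f).
Proof.
move=> /ideal_genP[k [c [s [Ss ->]]]]; rewrite cps_sumE.
apply: order_ge_sum => i _; rewrite cps_mulE.
by case: (Ss i) => j _ <-; apply/order_geMl/order_ge_var.
Qed.

Lemma order_ge_prod k (F : 'I_k -> O) : (forall i, order_ge 1 (cps_val (F i))) ->
  order_ge k (cps_val (\prod_i F i)).
Proof.
elim: k F => [//|k IH] F F1; rewrite big_ord_recl cps_mulE.
by apply: (@order_geM _ _ 1 k) => //; apply: IH.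
Qed.

(** A series of order [d] is divisible by the monomials of degree [d], which are
    products of [d] variables; conversely orders add under products. *)
Lemma ideal_exp_order d f :
  reflect (order_ge d (cps_val f)) (f \in ideal_exp (@max_ideal R K v n) d).
Proof.
apply: (iffP idP) => [/ideal_genP[k [c [s [Ss ->]]]]|fd].
  rewrite cps_sumE; apply: order_ge_sum => i _; rewrite cps_mulE.
  case: (Ss i) => F Fm <-; apply/order_geMl/order_ge_prod => j.
  by apply: max_ideal_order; apply: Fm.
have [g ->] := cps_quo_sum fd; apply: rpred_sum => b /eqP bd.
rewrite mulrC; apply/ideal_genM; apply/ideal_genP.
exists 1%N, (fun=> 1), (fun=> cps_mon b); split; last by rewrite big_ord1 mul1r.
move=> _; have [s ss ->] := cps_mon_prod b; rewrite bd in ss; case: _ / ss.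
exists (fun i => cps_var v (tnth (in_tuple s) i)); last by rewrite [RHS]big_tnth.
move=> i; apply/ideal_genP; exists 1%N, (fun=> 1), (fun=> cps_var v (tnth (in_tuple s) i)).
by split=> [_|]; [exists (tnth (in_tuple s) i)|rewrite big_ord1 mul1r].
Qed.

Lemma max_idealP f : reflect (order_ge 1 (cps_val f)) (f \in @max_ideal R K v n).
Proof.
apply: (iffP idP) => [|f1]; first exact: max_ideal_order.
have [g ->] := cps_quo_sum f1; apply: rpred_sum => b; rewrite mdeg_eq1.
move=> /existsP[i /eqP bE]; rewrite mulrC; apply/ideal_genM; apply/ideal_genP.
exists 1%N, (fun=> 1), (fun=> cps_var v i).
by split=> [_|]; [exists i|rewrite big_ord1 mul1r bE cps_mon1].
Qed.

Definition cps_head d f : O := \sum_(b : 'X_{1..n < d}) cps_val f b *: cps_mon b.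

Lemma cps_headE d f : cps_val (cps_head d f) = mfps_head d (cps_val f).
Proof. by rewrite cps_sumE. Qed.

Lemma order_ge_cps_tail d f : order_ge d (cps_val (f - cps_head d f)).
Proof. by rewrite cps_subE cps_headE; apply: order_ge_tail. Qed.

(** For [f = c (1 - p)] the inverse [z / c] is obtained by solving
    [z = 1 + p z]. *)
Lemma cps_unitP f : cps_val f 0%MM != 0 -> f \is a GRing.unit.
Proof.
move=> f0; pose c := cps_val f 0%MM; pose p : O := 1 - c^-1 *: f.
have p1 : order_ge 1 (cps_val p).
  move=> a; rewrite ltnS leqn0 mdeg_eq0 => /eqP ->.
  by rewrite cps_subE mfps_subE cps_oneE mfps_oneE eqxx cps_scaleE mfps_scaleE mulVf ?subrr.
have /convergent_bnd[r r0 [M pM]] := cps_valP p.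
have M0 := bnd_ge0 pM; pose s := r / (1 + 2 * M).
have M1 : 0 < 1 + 2 * M by lra.
have s0 : 0 < s by rewrite divr_gt0.
have sr : s <= r by rewrite ler_pdivrMr // ler_peMr ?(ltW r0) //; lra.
have ps : bnd v s (cps_val p) (2^-1).
  apply: bnd_leM (bnd_order s0 sr p1 pM).
  have -> : s / r = (1 + 2 * M)^-1 by rewrite /s mulrAC divff ?mul1r // gt_eqF.
  by rewrite expr1 mulrC ler_pdivrMr //; lra.
have [| |d z z' _ _ zz' i|z zB zT] := @formal_fixed_point R K v n unit 0 s 2
  (fun z _ => 1 + cps_val p * z tt).
- by [].
- move=> z zB i; split=> //; have -> : 2 = 1 + 2^-1 * 2 :> R by lra.
  apply: bndD; rewrite ?ltW //; first exact/bnd1/ltW.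
  by apply: bndM => //; [exact: ltW|case: (zB tt)].
- by rewrite opprD addrACA subrr add0r -mulrBr -add1n; apply: order_geM.
have zc : z tt \in convergent v (n := n).
  by apply/convergent_bnd; exists s => //; exists 2; case: (zB tt).
pose w : O := CPS zc.
have wp : w = 1 + p * w by apply: cps_inj; exact: esym (zT tt).
have cf : c^-1 *: f = 1 - p by rewrite /p opprB addrC subrK.
apply/(@cps_unitPl _ _ _ _ _ (c^-1 *: w)).
by rewrite -scalerAl scalerAr cf mulrBr mulr1 mulrC {1}wp addrK.
Qed.

End ConvergentAlgebra.

(** * Local endomorphisms and automorphisms *)

Section Substitutions.
Context (R : realType) (K : fieldType) (v : absolute_value R K) (n : nat).
Local Notation A := {mfps K[n]}.
Local Notation O := (cps v n).

Section Morphism.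
Context (h : 'I_n -> A) (hc : forall i, h i \in convergent v (n := n)).
Context (h1 : forall i, order_ge 1 (h i)).

Lemma convergent_subst (f : A) : f \in convergent v (n := n) ->
  mfps_subst f h \in convergent v (n := n).
Proof.
move=> /convergent_bnd[r r0 [M fM]]; apply/convergent_bnd.
have [r' r'0 [M' M'0 hM]] := convergent_bnd_fin hc.
pose s := Num.min r' (r' * r / M').
have s0 : 0 < s by rewrite lt_min r'0 !(mulr_gt0, invr_gt0).
have sr' : s <= r' by rewrite ge_min lexx.
exists s => //; exists M; apply: (bnd_subst (ltW s0) (ltW r0)) => // i.
apply: bnd_leM (bnd_order s0 sr' (h1 i) (hM i)).
rewrite expr1 mulrAC ler_pdivrMr // -ler_pdivlMr // (mulrC r).
by rewrite /s ge_min lexx orbT.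
Qed.

Definition cps_subst (f : O) : O := CPS (convergent_subst (cps_valP f)).

Fact cps_subst_linear : linear cps_subst.
Proof. by move=> c f g; apply/cps_inj/mfps_subst_linear. Qed.

Fact cps_subst_multiplicative : monoid_morphism cps_subst.
Proof.
by split=> [|f g]; apply: cps_inj; [apply: mfps_subst1|apply: mfps_substM].
Qed.

HB.instance Definition _ := GRing.isLinear.Build K O O _ cps_subst cps_subst_linear.
HB.instance Definition _ :=
  GRing.isMonoidMorphism.Build O O cps_subst cps_subst_multiplicative.

Lemma subst_morphism : exists phi : {lrmorphism O -> O},
  forall f, cps_val (phi f) = mfps_subst (cps_val f) h.
Proof. by exists (cps_subst : {lrmorphism O -> O}). Qed.

End Morphism.

Definition local_morphism (phi : O -> O) :=
  {homo phi : g / g \in @max_ideal R K v n}.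

Lemma local_morphism_order (phi : {lrmorphism O -> O}) d f :
  local_morphism phi -> order_ge d (cps_val f) -> order_ge d (cps_val (phi f)).
Proof.
move=> loc /ideal_exp_order/ideal_genP[k [c [s [Ss ->]]]].
rewrite rmorph_sum cps_sumE; apply: order_ge_sum => i _.
rewrite rmorphM cps_mulE; apply: order_geMl; case: (Ss i) => F Fm <-.
rewrite rmorph_prod; apply: order_ge_prod => j.
by apply: max_ideal_order; apply: loc; apply: Fm.
Qed.

(** Local morphisms are continuous for the order filtration, in which the
    polynomials are dense. *)
Lemma local_morphism_eq (phi psi : {lrmorphism O -> O}) :
  local_morphism phi -> local_morphism psi ->
  (forall i, phi (cps_var v i) = psi (cps_var v i)) -> phi =1 psi.
Proof.
move=> lphi lpsi eqv f; apply/cps_inj/order_ge_eq => d.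
have eqm b : phi (cps_mon v b) = psi (cps_mon v b).
  elim/mnm_rec: b => [|b i IH]; first by rewrite cps_mon0 !rmorph1.
  by rewrite cps_monD !rmorphM /= IH cps_mon1 eqv.
have eqh : phi (cps_head d f) = psi (cps_head d f).
  by rewrite !linear_sum; apply: eq_bigr => b _; rewrite !linearZ /= eqm.
have E : phi f - psi f = phi (f - cps_head d f) - psi (f - cps_head d f).
  by rewrite !rmorphB /= eqh opprB addrA subrK.
rewrite -cps_subE E cps_subE.
by apply: order_geB; apply: local_morphism_order => //; apply: order_ge_cps_tail.
Qed.

Definition perturbed_id (y : 'I_n -> A) (i : 'I_n) : A := mfps_var K i + y i.

Lemma order_ge_perturbed (y : 'I_n -> A) : (forall i, order_ge 1 (y i)) ->
  forall i, order_ge 1 (perturbed_id y i).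
Proof. by move=> y1 i; apply: order_geD => //; apply: order_ge_var. Qed.

Lemma convergent_perturbed (y : 'I_n -> A) :
  (forall i, y i \in convergent v (n := n)) ->
  forall i, perturbed_id y i \in convergent v (n := n).
Proof. by move=> yc i; apply: rpredD => //; apply: convergent_var. Qed.

Lemma mmap1_sub_order (h h' : 'I_n -> A) d b :
  (forall i, order_ge 1 (h i)) -> (forall i, order_ge 1 (h' i)) ->
  (forall i, order_ge d (h i - h' i)) ->
  order_ge (d + (mdeg b).-1) (mmap1 h b - mmap1 h' b).
Proof.
move=> h1 h'1 hd; elim/mnm_rec: b => [|b i IH].
  by rewrite !mmap11 subrr.
rewrite !mmap1D !mmap1U mdegD mdeg1 add1n /=.
have -> : h i * mmap1 h b - h' i * mmap1 h' b =
    (h i - h' i) * mmap1 h b + h' i * (mmap1 h b - mmap1 h' b).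
  by rewrite mulrBl mulrBr addrA subrK.
apply: order_geD; first by apply: order_geM => //; apply: order_ge_mmap1.
case bd : (mdeg b) IH => [|k] /= IH; last first.
  by apply: (@order_ge_le _ _ _ (1 + (d + k))); [rewrite addnCA|apply: order_geM].
by apply: order_geMl.
Qed.

(** Series of order [k] have difference quotients of order [k - 1]. *)
Lemma mfps_subst_sub_order (h h' : 'I_n -> A) d k f :
  (forall i, order_ge 1 (h i)) -> (forall i, order_ge 1 (h' i)) ->
  (forall i, order_ge d (h i - h' i)) -> order_ge k f ->
  order_ge (d + k.-1) (mfps_subst f h - mfps_subst f h').
Proof.
move=> h1 h'1 hd fk; rewrite -lsumB => a ad; apply: big1 => b _.
have [bk|kb] := ltnP (mdeg b) k; first by rewrite fk // mul0r.
rewrite (mmap1_sub_order h1 h'1 hd) ?mulr0 //.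
apply: leq_trans ad _; rewrite leq_add2l.
by case: k (mdeg b) kb {fk} => [|k] [|m].
Qed.

(** The right inverse [x + t] of [x + y] solves [t = - y(x + t)], a contraction
    because [y] has order 2. *)
Lemma perturbed_id_right_inverse (y : 'I_n -> A) :
  (forall i, y i \in convergent v (n := n)) -> (forall i, order_ge 2 (y i)) ->
  exists t : 'I_n -> A, [/\ forall i, t i \in convergent v (n := n),
    forall i, order_ge 2 (t i) &
    forall i, mfps_subst (perturbed_id y i) (perturbed_id t) = mfps_var K i].
Proof.
move=> yc y2; have [r r0 [M M0 yM]] := convergent_bnd_fin yc.
pose s := Num.min (r / 2) (r ^+ 2 / (4 * M)).
have s0 : 0 < s by rewrite lt_min !divr_gt0 ?exprn_gt0 ?mulr_gt0.
have sr : 2 * s <= r.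
  by rewrite mulrC -ler_pdivlMr // /s ge_min lexx.
have ball1 z : in_ball v 2 s s z -> forall i : 'I_n, order_ge 1 (perturbed_id z i).
  by move=> zB; apply: order_ge_perturbed => i; apply: order_ge_le (zB i).1.
have [|z zB|d z z' zB z'B zz' i|t tB tT] := @formal_fixed_point R K v n 'I_n 2 s s
  (fun z i => - mfps_subst (y i) (perturbed_id z)).
- exact: ltW.
- move=> i; split; first exact/order_geN/order_ge_subst/y2/ball1.
  have zs j : bnd v s (perturbed_id z j) (2 * s).
    rewrite mulr_natl mulr2n; apply: bndD; rewrite ?ltW //; last exact: (zB j).2.
    by apply: bnd_var; apply: ltW.
  have s20 : 0 < 2 * s by rewrite mulr_gt0.
  have := bnd_subst (ltW s0) (ltW s20) (ball1 z zB) zs (bnd_order s20 sr (y2 i) (yM i)).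
  move/bndN; apply: bnd_leM.
  have sM : s <= r ^+ 2 / (4 * M) by rewrite /s ge_min lexx orbT.
  rewrite ler_pdivlMr ?mulr_gt0 // in sM.
  rewrite expr_div_n mulrAC ler_pdivrMr ?exprn_gt0 //.
  apply: le_trans (ler_wpM2l (ltW s0) sM).
  by rewrite le_eqVlt; apply/orP; left; apply/eqP; ring.
- rewrite -opprD; apply: order_geN.
  rewrite -addn1; apply: (mfps_subst_sub_order _ _ _ (y2 i)).
  + exact: ball1.
  + exact: ball1.
  by move=> j; rewrite /perturbed_id opprD addrACA subrr add0r.
exists t; split=> i; first 1 last.
- exact: (tB i).1.
- have yi : mfps_subst (y i) (perturbed_id t) = - t i by rewrite -(tT i) opprK.
  have := mfps_substB (perturbed_id t) (perturbed_id y i) (y i).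
  rewrite {1}/perturbed_id addrK mfps_subst_var ?yi; last exact: ball1.
  by rewrite opprK => E; apply: (addIr (t i)); rewrite -E.
- by apply/convergent_bnd; exists s => //; exists s; apply: (tB i).2.
Qed.

Definition perturbs_id (phi : O -> O) (y : 'I_n -> A) :=
  forall f, cps_val (phi f) = mfps_subst (cps_val f) (perturbed_id y).

Lemma perturbs_id_local phi y : (forall i, order_ge 1 (y i)) ->
  perturbs_id phi y -> local_morphism phi.
Proof.
move=> y1 phiy f /max_idealP f1; apply/max_idealP; rewrite phiy.
exact/order_ge_subst/f1/order_ge_perturbed.
Qed.

Lemma perturbed_left_inverse (y : 'I_n -> A) (phi : {lrmorphism O -> O}) :
  (forall i, y i \in convergent v (n := n)) -> (forall i, order_ge 2 (y i)) ->
  perturbs_id phi y ->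
  exists t (psi : {lrmorphism O -> O}), [/\ forall i, t i \in convergent v (n := n),
    forall i, order_ge 2 (t i), perturbs_id psi t & cancel phi psi].
Proof.
move=> yc y2 phiy; have [t [tc t2 tT]] := perturbed_id_right_inverse yc y2.
have le12 (z : 'I_n -> A) : (forall i, order_ge 2 (z i)) -> forall i, order_ge 1 (z i).
  by move=> z2 i; apply: order_ge_le (z2 i).
have [psi psit] := subst_morphism (convergent_perturbed tc) (order_ge_perturbed (le12 t t2)).
exists t, psi; split=> //.
have lphi := perturbs_id_local (le12 y y2) phiy.
have lpsi := perturbs_id_local (le12 t t2) psit.
apply: (@local_morphism_eq (psi \o phi : {lrmorphism O -> O})
  (idfun : {lrmorphism O -> O})).
- by move=> f fm; apply/lpsi/lphi.
- by [].
move=> i; apply: cps_inj; rewrite /= psit phiy mfps_subst_var ?tT //.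
exact/order_ge_perturbed/le12.
Qed.

(** Inverse function theorem for coordinate changes tangent to the identity: such
    a substitution has a left inverse of the same kind, which itself has one, so
    the two are inverse to each other. *)
Lemma perturbed_aut (y : 'I_n -> A) :
  (forall i, y i \in convergent v (n := n)) -> (forall i, order_ge 2 (y i)) ->
  exists2 phi : {lrmorphism O -> O}, local_aut phi & perturbs_id phi y.
Proof.
move=> yc y2; have y1 i : order_ge 1 (y i) := order_ge_le (leqnSn 1) (y2 i).
have [phi phiy] := subst_morphism (convergent_perturbed yc) (order_ge_perturbed y1).
exists phi => //; split; last exact: perturbs_id_local phiy.
have [t [psi [tc t2 psit phiK]]] := perturbed_left_inverse yc y2 phiy.
have [_ [chi [_ _ _ psiK]]] := perturbed_left_inverse tc t2 psit.
exists psi => // f.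
by rewrite -[LHS]psiK phiK psiK.
Qed.

End Substitutions.

(** * Taylor expansion to second order *)

Section Taylor.
Context (R : realType) (K : fieldType) (v : absolute_value R K) (n : nat).
Local Notation A := {mfps K[n]}.
Implicit Types (f : A) (y z : 'I_n -> A) (b : 'X_{1..n}).

(** The linear part in [y] of [(x + y)^b]. *)
Definition taylor_lin y b : A := \sum_j mfps_deriv j (xmon K b) * y j.

Definition taylor_rem y b : A :=
  mmap1 (perturbed_id y) b - xmon K b - taylor_lin y b.

Lemma mfps_deriv1 (j : 'I_n) : mfps_deriv j (1 : A) = 0.
Proof.
have := mfps_derivM j (1 : A) 1; rewrite !mulr1 mul1r => E.
by apply: (addrI (mfps_deriv j 1)); rewrite addr0 -E.
Qed.

Lemma taylor_lin0 y : taylor_lin y 0%MM = 0.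
Proof. by apply: big1 => j _; rewrite xmon0 mfps_deriv1 mul0r. Qed.

Lemma taylor_linD y b i : taylor_lin y (U_(i) + b)%MM =
  xmon K b * y i + mfps_var K i * taylor_lin y b.
Proof.
rewrite /taylor_lin; under eq_bigr do rewrite xmonD xmon1 mfps_derivM mfps_deriv_var mulrDl.
rewrite big_split /= mulr_sumr; congr (_ + _); last by apply: eq_bigr => j _; rewrite mulrA.
rewrite (bigD1 i) //= eqxx mul1r big1 ?addr0 // => j ji.
by rewrite (negbTE ji) !mul0r.
Qed.

Lemma taylor_rem0 y : taylor_rem y 0%MM = 0.
Proof. by rewrite /taylor_rem mmap11 xmon0 taylor_lin0 !subrr. Qed.

Lemma taylor_remD y b i : taylor_rem y (U_(i) + b)%MM =
  perturbed_id y i * taylor_rem y b + y i * taylor_lin y b.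
Proof.
rewrite /taylor_rem taylor_linD mmap1D mmap1U xmonD xmon1 /perturbed_id; ring.
Qed.

Lemma order_ge_taylor_lin m y b : (forall i, order_ge m (y i)) ->
  order_ge m (taylor_lin y b).
Proof. by move=> ym; apply: order_ge_sum => j _; apply: order_geMl. Qed.

Lemma order_ge_taylor_rem m y b : (forall i, order_ge m (y i)) ->
  order_ge (m + m) (taylor_rem y b).
Proof.
move=> ym; elim/mnm_rec: b => [|b i IH]; first by rewrite taylor_rem0.
rewrite taylor_remD; apply: order_geD; first exact: order_geMl.
by apply: order_geM => //; apply: order_ge_taylor_lin.
Qed.

Lemma locally_finite_taylor_rem y : (forall i, order_ge 1 (y i)) ->
  locally_finite (taylor_rem y).
Proof.
move=> y1 b; apply: order_geB; last first.
  apply: order_ge_sum => j _; apply: order_geMr; apply: order_ge_deriv.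
  exact: order_ge_xmon.
apply: order_geB; last by apply: order_ge_le (leq_pred _) _; apply: order_ge_xmon.
exact/locally_finite_mmap1/order_ge_perturbed.
Qed.

Lemma taylor_lin_sub_order d y z b : (forall i, order_ge d (y i - z i)) ->
  order_ge d (taylor_lin y b - taylor_lin z b).
Proof.
move=> yz; rewrite -sumrB; apply: order_ge_sum => j _.
by rewrite -mulrBr; apply: order_geMl.
Qed.

Lemma taylor_rem_sub_order d m y z b :
  (forall i, order_ge m (y i)) -> (forall i, order_ge m (z i)) ->
  (forall i, order_ge d (y i - z i)) ->
  order_ge (d + m) (taylor_rem y b - taylor_rem z b).
Proof.
move=> ym zm yz; elim/mnm_rec: b => [|b i IH]; first by rewrite !taylor_rem0 subrr.
have -> : taylor_rem y (U_(i) + b)%MM - taylor_rem z (U_(i) + b)%MM =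
    (y i - z i) * (taylor_rem y b + taylor_lin y b) +
    (perturbed_id z i * (taylor_rem y b - taylor_rem z b) +
     z i * (taylor_lin y b - taylor_lin z b)).
  rewrite !taylor_remD /perturbed_id; ring.
apply: order_geD; last (apply: order_geD; first exact: order_geMl).
  apply: order_geM => //; apply: order_geD; last exact: order_ge_taylor_lin.
  by apply: order_ge_le (order_ge_taylor_rem _ ym); apply: leq_addr.
by rewrite addnC; apply: order_geM => //; apply: taylor_lin_sub_order.
Qed.

Lemma bnd_taylor_lin (s sg c : R) y b : 0 <= s -> 0 <= sg -> 0 <= c ->
  (forall i, bnd v s (y i) (c * sg)) ->
  bnd v s (taylor_lin y b) (c * (s + 2 * sg) ^+ mdeg b).
Proof.
move=> s0 sg0 c0 yb; elim/mnm_rec: b => [|b i IH].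
  by rewrite taylor_lin0 mdeg0 expr0 mulr1; apply: bnd_leM c0 (bnd0 _ _ _).
rewrite taylor_linD mdegD mdeg1 exprS.
apply: bnd_leM (bndD s0 (bndM s0 (bnd_xmon v b s0) (yb i))
  (bndM s0 (bnd_var v i s0) IH)).
have st : s ^+ mdeg b <= (s + 2 * sg) ^+ mdeg b.
  by apply: lerXn2r; rewrite ?nnegrE; lra.
have t0 : 0 <= (s + 2 * sg) ^+ mdeg b by rewrite exprn_ge0 //; lra.
have csg : 0 <= c * sg by rewrite mulr_ge0.
have H1 := ler_wpM2r csg st; have H2 := mulr_ge0 csg t0.
nra.
Qed.

(** Written as [c^2 t^|b|], the quadratic smallness of the remainder can be summed
    against the coefficients of a series bounded at radius [t].  In the recursion
    the cross term [y_i * taylor_lin y b] costs [sg] more than [s + sg], whence the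
    choice [t = s + 2 sg]. *)
Lemma bnd_taylor_rem (s sg c : R) y b : 0 <= s -> 0 <= sg -> 0 <= c -> c <= 1 ->
  (forall i, bnd v s (y i) (c * sg)) ->
  bnd v s (taylor_rem y b) (c ^+ 2 * (s + 2 * sg) ^+ mdeg b).
Proof.
move=> s0 sg0 c0 c1 yb; have c20 : 0 <= c ^+ 2 by rewrite exprn_ge0.
elim/mnm_rec: b => [|b i IH].
  by rewrite taylor_rem0 mdeg0 expr0 mulr1; apply: bnd_leM c20 (bnd0 _ _ _).
rewrite taylor_remD mdegD mdeg1 (exprS (s + 2 * sg)).
apply: bnd_leM (bndD s0 (bndM s0 (bndD s0 (bnd_var v i s0) (yb i)) IH)
  (bndM s0 (yb i) (bnd_taylor_lin b s0 sg0 c0 yb))).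
set t := (s + 2 * sg) ^+ mdeg b.
have t0 : 0 <= t by rewrite exprn_ge0 //; lra.
have -> : (s + c * sg) * (c ^+ 2 * t) + c * sg * (c * t) =
  c ^+ 2 * ((s + c * sg + sg) * t) by ring.
have csg := ler_wpM2r sg0 c1.
rewrite mul1r in csg; rewrite ler_wpM2l // ler_wpM2r //; lra.
Qed.

Definition taylor_remainder f y : A := lsum f (taylor_rem y).

Lemma lsum_deriv f j : lsum f (fun b => mfps_deriv j (xmon K b)) = mfps_deriv j f.
Proof.
apply: mfpsP => a; rewrite mfps_derivE.
have ad : (mdeg (a + U_(j))%MM < (mdeg a).+2)%N by rewrite mdegD mdeg1 addn1.
rewrite /lsum /= (bigD1 (BMultinom ad)) //= eqxx big1 ?addr0 ?mulrnAr ?mulr1 //.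
move=> b bE; case: eqVneq => [aE|_]; last by rewrite mul0rn mulr0.
by case/eqP: bE; apply: val_inj.
Qed.

Lemma taylor2 f y : (forall i, order_ge 1 (y i)) ->
  mfps_subst f (perturbed_id y) =
  f + \sum_j mfps_deriv j f * y j + taylor_remainder f y.
Proof.
move=> y1; rewrite /taylor_remainder !lsumB lsum_id lsum_sum.
have -> : \sum_j lsum f (fun b => mfps_deriv j (xmon K b) * y j) =
    \sum_j mfps_deriv j f * y j.
  apply: eq_bigr => j _; rewrite lsum_mulr ?lsum_deriv // => b.
  exact/order_ge_deriv/order_ge_xmon.
by rewrite -/(mfps_subst f _); ring.
Qed.

Lemma mfps_subst_increment f y : mfps_subst f (perturbed_id y) - f =
  lsum f (fun b => taylor_lin y b - - taylor_rem y b).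
Proof.
rewrite -{2}(lsum_id f) -lsumB; congr (lsum f _); apply/funext => b.
by rewrite /taylor_rem opprK [RHS]addrC subrK.
Qed.

Lemma order_ge_increment m f y : (forall i, order_ge m (y i)) ->
  order_ge m (mfps_subst f (perturbed_id y) - f).
Proof.
move=> ym; rewrite mfps_subst_increment; apply: order_ge_lsum => b.
rewrite opprK; apply: order_geD; first exact: order_ge_taylor_lin.
by apply: order_ge_le (order_ge_taylor_rem _ ym); apply: leq_addr.
Qed.

Lemma bnd_taylor_remainder s sg c M f y : 0 <= s -> 0 <= sg -> 0 <= c -> c <= 1 ->
  (forall i, order_ge 1 (y i)) -> (forall i, bnd v s (y i) (c * sg)) ->
  bnd v (s + 2 * sg) f M -> bnd v s (taylor_remainder f y) (c ^+ 2 * M).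
Proof.
move=> s0 sg0 c0 c1 y1 yb; have t0 : 0 <= s + 2 * sg by lra.
apply: bnd_lsum => //; first by rewrite exprn_ge0.
  exact: locally_finite_taylor_rem.
by move=> b; apply: bnd_taylor_rem.
Qed.

Lemma bnd_increment s sg c M f y : 0 <= s -> 0 <= sg -> 0 <= c -> c <= 1 ->
  (forall i, order_ge 1 (y i)) -> (forall i, bnd v s (y i) (c * sg)) ->
  bnd v (s + 2 * sg) f M ->
  bnd v s (mfps_subst f (perturbed_id y) - f) (2 * c * M).
Proof.
move=> s0 sg0 c0 c1 y1 yb; have t0 : 0 <= s + 2 * sg by lra.
rewrite mfps_subst_increment; apply: bnd_lsum => // [|b|b].
- by rewrite mulr_ge0.
- rewrite opprK; apply: order_geD; last exact: locally_finite_taylor_rem.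
  apply: order_ge_sum => j _; apply: order_geMr; apply: order_ge_deriv.
  exact: order_ge_xmon.
apply: bnd_leM (bndB s0 (bnd_taylor_lin b s0 sg0 c0 yb)
  (bndN (bnd_taylor_rem b s0 sg0 c0 c1 yb))).
have t : 0 <= (s + 2 * sg) ^+ mdeg b by rewrite exprn_ge0.
by rewrite -mulrDl ler_wpM2r //; nra.
Qed.

End Taylor.

(** * Solving for a coordinate change and a unit *)

Section Solve.
Context (R : realType) (K : fieldType) (v : absolute_value R K) (n : nat).
Local Notation A := {mfps K[n]}.
Local Notation O := (cps v n).

Lemma bndZ s c (f : A) M : bnd v s f M -> bnd v s (c *: f) (v c * M).
Proof.
move=> fM d; apply: le_trans (ler_wpM2l (absv_ge0 _ _) (fM d)).
rewrite mulr_sumr; apply: ler_sum => a _.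
by rewrite mfps_scaleE absvM mulrA.
Qed.

(** If an ideal contains all series of order [k], the coefficients expressing a
    series of order [k] in given generators can be chosen linearly, lowering the
    order by at most [k] and with polynomial control of the bounds as the radius
    shrinks: it suffices to treat the monomials of degree [k]. *)
Lemma bounded_ideal_section (J : finType) (G : J -> O) k :
  (forall h : O, order_ge k (cps_val h) -> exists c : J -> O, h = \sum_j c j * G j) ->
  exists (S : A -> J -> A) (r C : R), [/\ 0 < r, 0 < C &
    [/\ forall h, order_ge k h -> \sum_j S h j * cps_val (G j) = h,
        forall h h' j, S (h - h') j = S h j - S h' j,
        forall t h j, order_ge (k + t) h -> order_ge t (S h j) &
        forall s M h j, 0 < s -> s <= r -> bnd v s h M ->
          bnd v s (S h j) (C * (M / s ^+ k))]].
Proof.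
move=> H.
have cP (b : 'X_{1..n < k.+1}) : exists c : J -> O, mdeg b == k ->
    cps_mon v b = \sum_j c j * G j.
  have [bk|_] := eqVneq (mdeg b) k; last by exists (fun=> 0).
  have [|c cE] := H (cps_mon v b); first by rewrite -{1}bk; apply: order_ge_xmon.
  by exists c.
pose c b := projT1 (cid (cP b)).
have cE (b : 'X_{1..n < k.+1}) : mdeg b == k -> cps_mon v b = \sum_j c b j * G j.
  by rewrite /c; case: cid.
pose F (bj : 'X_{1..n < k.+1} * J) := cps_val (c bj.1 bj.2).
have [r r0 [M M0 FM]] := @convergent_bnd_fin R K v n _ F (fun bj => cps_valP _).
pose S h j := \sum_(b : 'X_{1..n < k.+1} | mdeg b == k) F (b, j) * mfps_quo b h.
exists S, r, (1 + \sum_(b : 'X_{1..n < k.+1} | mdeg b == k) M); split=> //.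
  by rewrite ltr_pwDl // sumr_ge0 // => b _; apply: ltW.
split=> [h hk|h h' j|t h j ht|s N h j s0 sr hN].
- rewrite [RHS](mfps_quo_sum hk).
  under eq_bigr do rewrite mulr_suml.
  rewrite exchange_big /=; apply: eq_bigr => b bk.
  have -> : xmon K b = cps_val (cps_mon v b) by [].
  rewrite (cE b bk) cps_sumE mulr_suml; apply: eq_bigr => j _.
  by rewrite cps_mulE mulrAC.
- by rewrite -sumrB; apply: eq_bigr => b _; rewrite mfps_quoB mulrBr.
- by apply: order_ge_sum => b /eqP bk; apply/order_geMl/(order_ge_quo bk).
have N0 : 0 <= N / s ^+ k by rewrite divr_ge0 ?exprn_ge0 ?(bnd_ge0 hN) // ltW.
apply: (@bnd_leM _ _ _ _ _ _ (\sum_(b : 'X_{1..n < k.+1} | mdeg b == k) M * (N / s ^+ k))).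
  by rewrite -mulr_suml ler_wpM2r // lerDr.
apply: bnd_sum => [|b /eqP bk]; first exact: ltW.
apply: bndM; [exact: ltW|exact: bnd_le (ltW s0) sr (FM _)|exact: bnd_quo].
Qed.

(** The generators of [<e f, j(f)>]: the Jacobian ideal for [e = 0], the Tjurina
    ideal for [e = 1]; this is how both equivalences are treated at once. *)
Definition scaled_tjurina_gens (e : K) (f : O) (j : 'I_n.+1) : O :=
  if unlift ord0 j is Some i then cps_deriv i f else e *: f.

Lemma scaled_tjurina_sum e f (c : 'I_n.+1 -> A) :
  \sum_j c j * cps_val (scaled_tjurina_gens e f j) =
  e *: (c ord0 * cps_val f) + \sum_i mfps_deriv i (cps_val f) * c (lift ord0 i).
Proof.
rewrite big_ord_recl /scaled_tjurina_gens unlift_none cps_scaleE -scalerAr.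
by congr (_ + _); apply: eq_bigr => i _; rewrite liftK mulrC.
Qed.

(** With [S] the section above, [w] and [y] are found as a fixed point of
    [S (g - f - Rem(y) - e w (f(x + y) - f))].  On series of order [k + 2] and
    size [s^(k+1)] at radius [s], the argument of [S] has order [2 k + 2] and
    size a constant times [s^(2 k + 2)], hence its image has size a constant times
    [s^(k + 2)], and a small enough [s] makes the map preserve the ball. *)
Lemma solve_unit_and_coordinates (e : K) (f g : O) k :
  (forall h : O, order_ge k (cps_val h) ->
     exists c, h = \sum_j c j * scaled_tjurina_gens e f j) ->
  order_ge (2 * k + 2) (cps_val (g - f)) ->
  exists (w : O) (y : 'I_n -> A), [/\ order_ge 1 (cps_val w),
    forall i, y i \in convergent v (n := n), forall i, order_ge 2 (y i) &
    cps_val g = (1 + e *: cps_val w) * mfps_subst (cps_val f) (perturbed_id y)].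
Proof.
move=> /bounded_ideal_section[S [r1 [C [r10 C0 [Ssum SB Sord Sbnd]]]]] q2.
set q : O := g - f in q2.
have [r r0 [M M0 fqM]] : exists2 r, 0 < r & exists2 M, 0 < M &
    forall i : bool, bnd v r (cps_val (if i then f else q)) M.
  by apply: convergent_bnd_fin => i; apply: cps_valP.
have fM := fqM true; have qM := fqM false; rewrite /= in fM qM.
(* With this choice [s <= sg] implies [s + 2 * sg <= r]. *)
pose sg := r / 3; have sg0 : 0 < sg by rewrite divr_gt0.
(* [E] bounds the argument of [S] in units of [s ^+ (2 * k + 2)]: its three terms
   come from [g - f], from the Taylor remainder and from the product of [w] with
   the increment of [f]. *)
pose E := M / r ^+ (2 * k + 2) + M / sg ^+ 2 + v e * 2 * M / sg.
have E0 : 0 <= E.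
  by rewrite !addr_ge0 // !mulr_ge0 ?invr_ge0 ?exprn_ge0 ?absv_ge0 // ltW.
(* The last bound gives [C * E * s <= 1], which keeps the image in the ball. *)
pose s := Num.min (Num.min sg r1) (Num.min 1 (1 / (1 + C * E))).
have CE0 : 0 <= C * E by rewrite mulr_ge0 // ltW.
have s0 : 0 < s by rewrite !lt_min sg0 r10 ltr01 divr_gt0 //; lra.
have [ssg sr1 s1 sCE] : [/\ s <= sg, s <= r1, s <= 1 & C * E * s <= 1].
  split; rewrite ?[s <= _]ge_min ?ge_min ?lexx ?orbT //.
  apply: (@le_trans _ _ ((1 + C * E) * s)).
    by rewrite mulrDl mul1r lerDr ltW.
  by rewrite mulrC -ler_pdivlMr ?ge_min ?ge_min ?lexx ?orbT //; lra.
have sr : s <= r by apply: le_trans ssg _; rewrite /sg; lra.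
have s2r : s + 2 * sg <= r by rewrite /sg in ssg *; lra.
have s2r0 : 0 <= s + 2 * sg by rewrite addr_ge0 ?mulr_ge0 // ltW.
have fM' : bnd v (s + 2 * sg) (cps_val f) M := bnd_le s2r0 s2r fM.
pose rho := s ^+ k.+1; have rho0 : 0 < rho by rewrite exprn_gt0.
pose c := rho / sg; have c0 : 0 <= c by rewrite divr_ge0 // ltW.
have c1 : c <= 1.
  rewrite ler_pdivrMr // mul1r; apply: le_trans ssg.
  by rewrite /rho exprS ler_piMr ?(ltW s0) // exprn_ile1 ?(ltW s0).
have cE : c * sg = rho by rewrite divfK // gt_eqF.
pose yy (z : 'I_n.+1 -> A) i := z (lift ord0 i).
pose fy z := mfps_subst (cps_val f) (perturbed_id (yy z)).
pose Q z := cps_val q - taylor_remainder (cps_val f) (yy z)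
  - e *: (z ord0 * (fy z - cps_val f)).
pose ball (z : 'I_n.+1 -> A) := in_ball v k.+2 s rho z.
have ball1 z : ball z -> forall i, order_ge 1 (yy z i).
  by move=> zB i; apply: order_ge_le (zB _).1.
have Q2 z : ball z -> order_ge (k + k.+2) (Q z).
  have kk : (k + k.+2 = 2 * k + 2)%N by rewrite !addnS addn0 mul2n addnn.
  have kk2 : (k + k.+2 <= k.+2 + k.+2)%N by rewrite leq_add2r !leqW.
  move=> zB; apply: order_geB; first (apply: order_geB; first by rewrite kk).
    apply: order_ge_lsum => b; apply: order_ge_le kk2 _.
    by apply: order_ge_taylor_rem => i; apply: (zB _).1.
  apply/order_geZ/(order_ge_le kk2)/order_geM; first exact: (zB _).1.
  by apply: order_ge_increment => i; apply: (zB _).1.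
have [|z zB|d z z' zB z'B zz' j|z zB zT] :=
  @formal_fixed_point R K v n 'I_n.+1 k.+2 s rho (fun z => S (Q z)).
- exact: ltW.
- move=> j; split; first exact/Sord/Q2.
  have yb i : bnd v s (yy z i) (c * sg) by rewrite cE; apply: (zB _).2.
  have Qb : bnd v s (Q z) (s ^+ (2 * k + 2) * E).
    apply: bnd_leM (bndB (ltW s0) (bndB (ltW s0) (bnd_order s0 sr q2 qM)
      (bnd_taylor_remainder (ltW s0) (ltW sg0) c0 c1 (ball1 z zB) yb fM'))
      (bndZ e (bndM (ltW s0) (zB ord0).2
        (bnd_increment (ltW s0) (ltW sg0) c0 c1 (ball1 z zB) yb fM')))).
    have -> : s ^+ (2 * k + 2) = rho ^+ 2 by rewrite /rho -exprM muln2 -mul2n mulnS addnC.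
    rewrite le_eqVlt; apply/orP; left; apply/eqP.
    rewrite expr_div_n {1}(_ : s ^+ (2 * k + 2) = rho ^+ 2); last first.
      by rewrite /rho -exprM muln2 -mul2n mulnS addnC.
    rewrite /c /E; field.
    by rewrite !gt_eqF ?exprn_gt0.
  apply: bnd_leM (Sbnd s _ _ j s0 sr1 Qb).
  have -> : (2 * k + 2 = k + k.+2)%N by rewrite !addnS addn0 mul2n addnn.
  rewrite exprD mulrAC [_ * s ^+ _ / _]mulrAC divff ?gt_eqF ?exprn_gt0 // mul1r.
  have -> : C * (s ^+ k.+2 * E) = C * E * s * rho by rewrite /rho !exprS; ring.
  by rewrite ler_piMl // ltW.
- rewrite -SB; apply: Sord.
  have rearrange (q0 t x t' x' : A) : q0 - t - x - (q0 - t' - x') = x' - x - (t - t').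
    by ring.
  have -> : Q z - Q z' = e *: ((z' ord0 - z ord0) * (fy z' - cps_val f) +
      z ord0 * (fy z' - fy z)) - (taylor_remainder (cps_val f) (yy z) -
      taylor_remainder (cps_val f) (yy z')).
    rewrite /Q.
    have -> : (z' ord0 - z ord0) * (fy z' - cps_val f) + z ord0 * (fy z' - fy z) =
      z' ord0 * (fy z' - cps_val f) - z ord0 * (fy z - cps_val f) by ring.
    by rewrite scalerBr rearrange.
  have dk : (k + d.+1 <= d + k.+2)%N by rewrite addnS (addnC k) !addnS leqnSn.
  apply: (order_ge_le dk); apply: order_geB.
    apply/order_geZ/order_geD.
      apply: order_geM; first exact/order_ge_sym/zz'.
      by apply: order_ge_increment => i; apply: (z'B _).1.
    rewrite addnC; apply: order_geM; first exact: (zB _).1.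
    rewrite -[d]addn0; apply: (@mfps_subst_sub_order _ _ _ _ d 0) => //.
    + exact/order_ge_perturbed/ball1.
    + exact/order_ge_perturbed/ball1.
    + by move=> i; rewrite /perturbed_id opprD addrACA subrr add0r; apply/order_ge_sym/zz'.
  rewrite -lsumB; apply: order_ge_lsum => b; apply: taylor_rem_sub_order => i.
  + exact: (zB _).1.
  + exact: (z'B _).1.
  + exact: zz'.
have zc j : z j \in convergent v (n := n).
  by apply/convergent_bnd; exists s => //; exists rho; apply: (zB j).2.
exists (CPS (zc ord0)), (yy z); split=> [|i|i|].
- exact: order_ge_le (zB _).1.
- exact: zc.
- exact: order_ge_le (zB _).1.
have := Ssum (Q z) (order_ge_le (leq_addr _ _) (Q2 z zB)).
under eq_bigr do rewrite zT.
rewrite scaled_tjurina_sum -/(yy z).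
have := taylor2 (cps_val f) (ball1 z zB); rewrite -/(fy z) /=.
set F := fy z; set D := \sum_i _ => FE.
rewrite /Q -/F {1}/q cps_subE mulrBr scalerBr => EQ.
rewrite mulrDl mul1r -scalerAl.
set X := e *: (z ord0 * F) in EQ *; set Y := e *: (z ord0 * cps_val f) in EQ.
set T := taylor_remainder _ _ in FE EQ.
have -> : cps_val g = cps_val g - cps_val f - T - (X - Y) + (X - Y) + T + cps_val f.
  by ring.
rewrite -EQ FE; ring.
Qed.

End Solve.

(** * Ideals of finite codimension *)

Section Ideals.
Context (A : comNzRingType).
Implicit Types (S T : set A).

Lemma mem_ideal_gen S x : S x -> x \in ideal_gen S.
Proof.
move=> Sx; apply/ideal_genP; exists 1%N, (fun=> 1), (fun=> x).
by rewrite big_ord1 mul1r.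
Qed.

Lemma ideal_gen_sub S T : (forall x, S x -> x \in ideal_gen T) ->
  forall x, x \in ideal_gen S -> x \in ideal_gen T.
Proof.
move=> ST x /ideal_genP[k [a [s [Ss ->]]]].
by apply: rpred_sum => i _; apply/ideal_genM/ST.
Qed.

Lemma ideal_gen_rangeP (J : finType) (G : J -> A) x :
  x \in ideal_gen (range G) -> exists c : J -> A, x = \sum_j c j * G j.
Proof.
move=> /ideal_genP[k [a [s [Ss ->]]]].
have jP i : exists j, G j = s i by have [j _ <-] := Ss i; exists j.
pose j i := projT1 (cid (jP i)).
exists (fun j0 => \sum_(i | j i == j0) a i).
rewrite (partition_big j xpredT) //=; apply: eq_bigr => j0 _.
rewrite mulr_suml; apply: eq_bigr => i /eqP <-.
by rewrite /j; case: cid => j1 /= ->.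
Qed.

End Ideals.

Section Bases.
Context (K : fieldType) (V : lmodType K).

Lemma basis_of_spanning m (e : 'I_m -> V) :
  (forall x, exists c : 'I_m -> K, x = \sum_i c i *: e i) ->
  exists k (e' : 'I_k -> V), is_basis e'.
Proof.
elim: m e => [|m IH] e span.
  by exists 0%N, e; split=> // c _ [].
have [free|] := pselect (forall c : 'I_m.+1 -> K, \sum_i c i *: e i = 0 -> forall i, c i = 0).
  by exists m.+1, e.
move=> /existsNP[c /not_implyP[c0 /existsNP[i0 /eqP ci0]]].
apply: (IH (fun i => e (lift i0 i))) => x; have [a ->] := span x.
have ei0 : e i0 = \sum_i (- (c i0)^-1 * c (lift i0 i)) *: e (lift i0 i).
  move: c0; rewrite (bigD1_ord i0) //= => /eqP; rewrite addr_eq0 => /eqP c0.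
  rewrite -[LHS]scale1r -(mulVf ci0) -scalerA c0 scalerN -scaleNr scaler_sumr.
  by apply: eq_bigr => i _; rewrite scalerA.
exists (fun i => a i0 * (- (c i0)^-1 * c (lift i0 i)) + a (lift i0 i)).
rewrite (bigD1_ord i0) //= ei0 scaler_sumr -big_split; apply: eq_bigr => i _.
by rewrite scalerDl scalerA.
Qed.

End Bases.

Section FiniteCodimension.
Context (R : realType) (K : fieldType) (v : absolute_value R K) (n : nat).
Local Notation O := (cps v n).
Implicit Types (S : set O).

(** The ideal generated by [S] contains the [k]-th power of the maximal ideal. *)
Definition contains_order S k :=
  forall h : O, order_ge k (cps_val h) -> h \in ideal_gen S.

Lemma cps_mon_exp i j : cps_mon v (U_(i) *+ j)%MM = cps_var v i ^+ j :> O.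
Proof.
elim: j => [|j IH]; first by rewrite mulm0n cps_mon0.
by rewrite mulmS cps_monD IH cps_mon1 exprS.
Qed.

Lemma mnm_large_exponent m (b : 'X_{1..n}) : (n * m < mdeg b)%N ->
  exists i, (U_(i) *+ m <= b)%MM.
Proof.
move=> mb; have /existsP[i mi] : [exists i, (m <= b i)%N].
  apply: contraLR mb; rewrite negb_exists -leqNgt => /forallP bm.
  rewrite mdegE -[n in (n * m)%N]card_ord -sum_nat_const; apply: leq_sum => i _.
  by apply: ltnW; rewrite ltnNge bm.
exists i; apply/mnm_lepP => j; rewrite mulmnE mnm1E.
by case: eqVneq => [<-|_]; rewrite ?mul1n ?mul0n.
Qed.

Lemma contains_order_of_powers S m :
  (forall i, cps_var v i ^+ m \in ideal_gen S) -> contains_order S (n * m).+1.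
Proof.
move=> xm h /cps_quo_sum[g ->]; apply: rpred_sum => b /eqP bd.
have [i ib] : exists i, (U_(i) *+ m <= b)%MM by apply: mnm_large_exponent; rewrite bd.
rewrite mulrC; apply: ideal_genM.
by rewrite -(submK ib) cps_monD cps_mon_exp; apply: ideal_genM.
Qed.

(** A nonzero polynomial in a variable is a power of that variable times a
    unit, so a polynomial relation modulo an ideal puts a power in the ideal. *)
Lemma power_of_relation S i m (u : nat -> K) (y : O) :
  (exists2 j, (j < m)%N & u j != 0) ->
  (\sum_(j < m) u j *: cps_var v i ^+ j) * y \in ideal_gen S ->
  cps_var v i ^+ m * y \in ideal_gen S.
Proof.
elim: m u y => [|m IH] u y [j jm uj]; first by [].
rewrite big_ord_recl expr0.
have shift : \sum_(l < m) u (bump 0 l) *: cps_var v i ^+ bump 0 l =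
    (\sum_(l < m) u l.+1 *: cps_var v i ^+ l) * cps_var v i.
  by rewrite mulr_suml; apply: eq_bigr => l _; rewrite -scalerAl -exprSr.
rewrite shift; have [u0|u0] := eqVneq (u 0%N) 0; last first.
  set p := _ + _ => py; have pu : p \is a GRing.unit.
    apply: cps_unitP; rewrite cps_addE mfps_addE cps_scaleE mfps_scaleE.
    rewrite cps_oneE mfps_oneE eqxx mulr1 [X in _ + X](_ : _ = 0) ?addr0 //.
    apply: (order_geMl (d := 1)); first exact: order_ge_var.
    by rewrite mdeg0.
  by apply: ideal_genM; rewrite -[y](mulKr pu); apply: ideal_genM.
rewrite u0 scale0r add0r -mulrA => px.
rewrite exprSr -mulrA; apply: (IH (fun j => u j.+1)) px.
case: j jm uj => [|j]; first by rewrite u0 eqxx.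
by move=> jm uj; exists j.
Qed.

Lemma power_of_finite_span S (L : finType) (E : L -> O) i :
  (forall j, exists c : L -> K,
     cps_var v i ^+ j - \sum_l c l *: E l \in ideal_gen S) ->
  cps_var v i ^+ #|L|.+1 \in ideal_gen S.
Proof.
move=> span; pose c j := projT1 (cid (span j)).
have cP j : cps_var v i ^+ j - \sum_l c j l *: E l \in ideal_gen S.
  by rewrite /c; case: cid.
pose M := \matrix_(j < #|L|.+1, l < #|L|) c j (enum_val l).
have : kermx M != 0.
  by rewrite kermx_eq0 /row_free neq_ltn ltnS rank_leq_col.
move=> /rowV0Pn[w /sub_kermxP wM w0].
pose u j := if insub j is Some j' then w 0 (j' : 'I_#|L|.+1) else 0.
have uE (j : 'I_#|L|.+1) : u j = w 0 j by rewrite /u valK.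
rewrite -[_ ^+ _]mulr1; apply: (@power_of_relation _ _ _ u).
  have /existsP[j wj] : [exists j, w 0 j != 0].
    apply: contraR w0; rewrite negb_exists => /forallP wz.
    by apply/eqP/rowP => j; rewrite mxE; have /negPn/eqP := wz j.
  by exists j; rewrite ?uE.
rewrite mulr1.
have -> : \sum_(j < #|L|.+1) u j *: cps_var v i ^+ j =
    \sum_(j < #|L|.+1) (u j)%:A * (cps_var v i ^+ j - \sum_l c j l *: E l).
  under [RHS]eq_bigr do rewrite mulr_algl scalerBr scaler_sumr.
  rewrite sumrB [X in _ - X](_ : _ = 0) ?subr0 // exchange_big big1 //= => l _.
  under eq_bigr do rewrite scalerA.
  rewrite -scaler_suml.
  have /matrixP/(_ 0 (enum_rank l)) := wM; rewrite !mxE => wMl.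
  rewrite -[X in X *: _](_ : 0 = _) ?scale0r // -[LHS]wMl.
  by apply: eq_bigr => j _; rewrite uE mxE enum_rankK.
by apply: rpred_sum => j _; apply: ideal_genM.
Qed.

Local Notation Q S := {ideal_quot (ideal_gen S)}.
Local Open Scope quotient_scope.

Lemma pi_sum S (I : finType) (c : I -> K) (x : I -> O) :
  \pi_(Q S) (\sum_i c i *: x i) = \sum_i c i *: (\pi_(Q S) (x i) : Q S).
Proof.
rewrite raddf_sum; apply: eq_bigr => i _; exact: pi_ideal_quot_scale.
Qed.

(** If the quotient has a finite basis, representatives of it span the powers of
    each variable modulo the ideal; conversely the monomials of degree less than
    [k] span the quotient by an ideal containing the [k]-th power of the maximal
    ideal. *)
Lemma finite_codimension_order S :
  (kdim R (Q S) < +oo)%E <-> exists k, contains_order S k.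
Proof.
split=> [fin|[k kS]].
  have [m [e [_ span]]] : exists m (e : 'I_m -> Q S), is_basis e.
    apply: contrapT => none; move: fin; rewrite /kdim.
    rewrite [X in ereal_inf X](_ : _ = classical_sets.set0) ?ereal_inf0 ?ltxx //.
    apply/seteqP; split=> // x [m [e eb] _]; apply: none; by exists m, e.
  exists (n * #|'I_m|.+1).+1; apply: contains_order_of_powers => i.
  apply: (@power_of_finite_span _ _ (fun l => repr (e l))) => j.
  have [c cE] := span (\pi_(Q S) (cps_var v i ^+ j)); exists c.
  rewrite Quotient.idealrBE; apply/eqP; rewrite pi_sum cE.
  by apply: eq_bigr => l _; rewrite reprK.
have [|m [e eb]] := @basis_of_spanning K (Q S) #|{: 'X_{1..n < k}}|
    (fun l => \pi_(Q S) (cps_mon v (enum_val l : 'X_{1..n < k}))).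
  move=> x; exists (fun l => cps_val (repr x) (enum_val l : 'X_{1..n < k})).
  rewrite -(@big_enum_val _ _ _ _ _
    (fun b : 'X_{1..n < k} => cps_val (repr x) b *: (\pi_(Q S) (cps_mon v b) : Q S))).
  rewrite -pi_sum -[LHS]reprK; apply/eqP; rewrite -Quotient.idealrBE.
  exact/kS/order_ge_cps_tail.
apply: le_lt_trans (ltry m%:R); apply: ereal_inf_lbound.
by exists m => //; exists e.
Qed.

End FiniteCodimension.

(** * A perturbation of high order with an isolated critical point *)

Section Derivations.
Context (R : realType) (K : fieldType) (v : absolute_value R K) (n : nat).
Local Notation O := (cps v n).

Lemma cps_derivD i (f g : O) :
  cps_deriv i (f + g) = cps_deriv i f + cps_deriv i g.
Proof. exact/cps_inj/mfps_derivD. Qed.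

Lemma cps_derivM i (f g : O) :
  cps_deriv i (f * g) = cps_deriv i f * g + f * cps_deriv i g.
Proof. exact/cps_inj/mfps_derivM. Qed.

Lemma cps_derivZ i c (f : O) : cps_deriv i (c *: f) = c *: cps_deriv i f.
Proof. by apply/cps_inj/mfpsP => a; rewrite /= mulrnAr. Qed.

Lemma cps_derivB i (f g : O) :
  cps_deriv i (f - g) = cps_deriv i f - cps_deriv i g.
Proof. by rewrite cps_derivD -scaleN1r cps_derivZ scaleN1r. Qed.

Lemma cps_deriv0 i : cps_deriv i (0 : O) = 0.
Proof. by rewrite -(scale0r 0) cps_derivZ !scale0r. Qed.

Lemma cps_deriv1 i : cps_deriv i (1 : O) = 0.
Proof. exact/cps_inj/mfps_deriv1. Qed.

Lemma cps_deriv_sum i (I : Type) (r : seq I) (P : pred I) (F : I -> O) :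
  cps_deriv i (\sum_(j <- r | P j) F j) = \sum_(j <- r | P j) cps_deriv i (F j).
Proof.
by elim/big_rec2: _ => [|j x y _ <-]; [apply: cps_deriv0|apply: cps_derivD].
Qed.

Lemma cps_deriv_var (i j : 'I_n) : cps_deriv i (cps_var v j) = (i == j)%:R.
Proof. by apply: cps_inj; rewrite [LHS]mfps_deriv_var; case: (i == j). Qed.

Lemma cps_deriv_exp i (f : O) m :
  cps_deriv i (f ^+ m) = (f ^+ m.-1 * cps_deriv i f) *+ m.
Proof.
elim: m => [|m IH]; first by rewrite expr0 cps_deriv1.
rewrite exprS cps_derivM IH mulrC [in LHS]mulrnAr mulrA mulrS; congr (_ + _).
by case: m {IH} => [|m]; rewrite ?mulr0n //= -exprS.
Qed.

End Derivations.

Section IsolatedPerturbation.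
Context (R : realType) (K : fieldType) (v : absolute_value R K) (n : nat).
Local Notation O := (cps v n).

(** If modulo an ideal each [x_i^m] is a polynomial of degree less than [m], then
    every monomial reduces to monomials of bounded degree, so the powers of each
    variable span a finite-dimensional space modulo the ideal. *)
Lemma contains_order_of_reduction (S : set O) m (rho : 'I_n -> O) :
  (forall i, cps_var v i ^+ m - cps_head m (rho i) \in ideal_gen S) ->
  exists k, contains_order S k.
Proof.
move=> red; set D := (n * m).+1.
pose spn x := exists c : 'X_{1..n < D} -> K,
  x - \sum_l c l *: cps_mon v l \in ideal_gen S.
have spnI x : x \in ideal_gen S -> spn x.
  by exists (fun=> 0); rewrite big1 ?subr0 // => l _; rewrite scale0r.
have spnD x y : spn x -> spn y -> spn (x + y).
  move=> [c cx] [d dy]; exists (fun l => c l + d l).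
  under eq_bigr do rewrite scalerDl.
  by rewrite big_split opprD addrACA; apply: rpredD.
have spnZ c x : spn x -> spn (c *: x).
  move=> [d dx]; exists (fun l => c * d l).
  under eq_bigr do rewrite -scalerA.
  by rewrite -scaler_sumr -scalerBr -mulr_algl; apply: ideal_genM.
have spn_sum (I : finType) (F : I -> O) : (forall i, spn (F i)) -> spn (\sum_i F i).
  by move=> Fs; elim/big_ind: _ => //; apply: spnI; apply: rpred0.
have spn_mon b : spn (cps_mon v b).
  elim: {b}(mdeg b).+1 {-2}b (ltnSn (mdeg b)) => // e IH b be.
  have [bD|Db] := ltnP (mdeg b) D.
    exists (fun l => (bmnm l == b)%:R); rewrite (bigD1 (BMultinom bD)) //= eqxx scale1r.
    rewrite big1 ?addr0 ?subrr ?rpred0 // => l lb.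
    case: eqVneq => [lE|_]; last by rewrite scale0r.
    by case/eqP: lb; apply: val_inj.
  have [i ib] := mnm_large_exponent Db.
  set b' := (b - U_(i) *+ m)%MM.
  have bE : mdeg b = (mdeg b' + m)%N by rewrite -{1}(submK ib) mdegD mdegMn mdeg1 mul1n.
  have -> : cps_mon v b = cps_mon v b' * (cps_var v i ^+ m - cps_head m (rho i)) +
      \sum_(l : 'X_{1..n < m}) cps_val (rho i) l *: cps_mon v (b' + l)%MM.
    rewrite -{1}(submK ib) cps_monD cps_mon_exp mulrBr -addrA.
    rewrite [X in _ + X](_ : _ = 0) ?addr0 // mulr_sumr addrC -sumrB big1 // => l _.
    by rewrite -scalerAr cps_monD subrr.
  apply: spnD; first by apply/spnI/ideal_genM.
  apply: spn_sum => l; apply/spnZ/IH.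
  rewrite mdegD -ltnS; apply: leq_trans be; rewrite ltnS bE ltn_add2l.
  exact: bmdeg.
exists (n * #|{: 'X_{1..n < D}}|.+1).+1; apply: contains_order_of_powers => i.
apply: (@power_of_finite_span _ _ _ _ _ _ (fun l : 'X_{1..n < D} => cps_mon v l)).
by move=> j; rewrite -cps_mon_exp; apply: spn_mon.
Qed.

Lemma large_invertible_nat d : exists2 N, (d <= N)%N & N%:R != 0 :> K.
Proof.
have [d0|d0] := eqVneq (d%:R : K) 0; last by exists d.
by exists d.+1 => //; rewrite -addn1 natrD d0 add0r oner_eq0.
Qed.

(** Replace the terms of degree greater than [d] by [\sum_i x_i^N]: the partial
    derivatives become [N x_i^(N-1)] plus polynomials of degree less than
    [d].  Choosing [N] invertible in [K] makes this work in every
    characteristic, and over finite fields, where generic perturbations may not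
    exist. *)
Lemma isolated_perturbation (f : O) d : exists g : O,
  order_ge d.+1 (cps_val (f - g)) /\ exists k, contains_order (jacobian_gens g) k.
Proof.
have [N dN N0] := large_invertible_nat d.+2.
pose h := cps_head d.+1 f; pose g := h + \sum_i cps_var v i ^+ N.
exists g; split.
  rewrite /g opprD addrA cps_subE; apply: order_geB; first exact: order_ge_cps_tail.
  rewrite cps_sumE; apply: order_ge_sum => i _; apply: (@order_ge_le _ _ _ N).
    exact: ltnW.
  rewrite -cps_mon_exp -[N in order_ge N _](_ : mdeg (U_(i) *+ N)%MM = N).
    exact: order_ge_xmon.
  by rewrite mdegMn mdeg1 mul1n.
pose rho i : O := - (N%:R^-1 *: cps_deriv i h).
apply: (@contains_order_of_reduction _ N.-1 rho) => i.
have -> : cps_head N.-1 (rho i) = rho i.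
  apply/cps_inj/mfpsP => a; rewrite cps_headE mfps_headE; case: ifP => // /negbT.
  rewrite -leqNgt => Na; rewrite (_ : cps_val (rho i) a =
    - (N%:R^-1 * (cps_val h (a + U_(i))%MM *+ (a i).+1))) // cps_headE mfps_headE.
  rewrite mdegD mdeg1 addn1 ltnS ltnNge (leq_trans _ Na) ?mul0rn ?mulr0 ?oppr0 //.
  by case: N dN {N0 g rho Na} => // N /ltnW.
have gE : cps_deriv i g = cps_deriv i h + cps_var v i ^+ N.-1 *+ N.
  rewrite cps_derivD; congr (_ + _).
  rewrite cps_deriv_sum (bigD1 i) //= cps_deriv_exp cps_deriv_var eqxx mulr1.
  rewrite big1 ?addr0 // => j ji.
  by rewrite cps_deriv_exp cps_deriv_var eq_sym (negbTE ji) mulr0 mul0rn.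
have -> : cps_var v i ^+ N.-1 - rho i = (N%:R^-1)%:A * cps_deriv i g.
  rewrite mulr_algl gE scalerDr opprK addrC; congr (_ + _).
  by rewrite -scaler_nat scalerA mulVf ?scale1r.
by apply/ideal_genM/mem_ideal_gen; exists i.
Qed.

End IsolatedPerturbation.

(** * Invariance of finite codimension under automorphisms *)

Section Invariance.
Context (R : realType) (K : fieldType) (v : absolute_value R K) (n : nat).
Local Notation O := (cps v n).

(** Both sides are derivations along [psi] agreeing on the variables, hence on
    polynomials; they lower orders by at most one, so density concludes. *)
Lemma chain_rule (psi : {lrmorphism O -> O}) i f : local_morphism psi ->
  cps_deriv i (psi f) =
  \sum_j psi (cps_deriv j f) * cps_deriv i (psi (cps_var v j)).
Proof.
move=> lpsi; pose D h := \sum_j psi (cps_deriv j h) * cps_deriv i (psi (cps_var v j)).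
pose agree h := cps_deriv i (psi h) = D h.
have agreeD h h' : agree h -> agree h' -> agree (h + h').
  rewrite /agree rmorphD cps_derivD => -> ->; rewrite -big_split.
  by apply: eq_bigr => j _; rewrite cps_derivD rmorphD mulrDl.
have agreeZ c h : agree h -> agree (c *: h).
  rewrite /agree linearZ cps_derivZ => ->; rewrite scaler_sumr.
  by apply: eq_bigr => j _; rewrite cps_derivZ linearZ scalerAl.
have agreeM h h' : agree h -> agree h' -> agree (h * h').
  rewrite /agree rmorphM cps_derivM => -> ->; rewrite mulr_suml mulr_sumr -big_split.
  by apply: eq_bigr => j _; rewrite cps_derivM rmorphD !rmorphM mulrDl /=; ring.
have agree1 : agree 1.
  rewrite /agree rmorph1 cps_deriv1 [RHS]big1 // => j _.
  by rewrite cps_deriv1 rmorph0 mul0r.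
have agree_mon b : agree (cps_mon v b).
  elim/mnm_rec: b => [|b j IH]; first by rewrite cps_mon0.
  rewrite cps_monD cps_mon1; apply: agreeM => //.
  rewrite /agree /D (bigD1 j) //= cps_deriv_var eqxx rmorph1 mul1r big1 ?addr0 // => l lj.
  by rewrite cps_deriv_var (negbTE lj) rmorph0 mul0r.
have agree_head d : agree (cps_head d f).
  rewrite /cps_head; elim/big_ind: _ => [||b _]; [|exact: agreeD|exact: agreeZ].
  by rewrite -(scale0r 1); apply: agreeZ.
have Dsub h h' : D (h - h') = D h - D h'.
  rewrite -sumrB; apply: eq_bigr => j _.
  by rewrite cps_derivB rmorphB mulrBl.
apply/cps_inj/order_ge_eq => d; have hd := agree_head d.+1.
have td := @order_ge_cps_tail _ _ _ _ d.+1 f; set h := cps_head d.+1 f in hd td.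
have E : cps_deriv i (psi f) - D f = cps_deriv i (psi (f - h)) - D (f - h).
  by rewrite Dsub -hd rmorphB cps_derivB opprB addrA subrK.
rewrite -cps_subE E cps_subE; apply: order_geB.
  exact: (@order_ge_deriv _ _ i d.+1 _ (local_morphism_order lpsi td)).
rewrite cps_sumE; apply: order_ge_sum => j _; rewrite cps_mulE; apply: order_geMr.
apply: local_morphism_order => //.
exact: (@order_ge_deriv _ _ j d.+1 _ td).
Qed.

Section Inverse.
Context (phi : {lrmorphism O -> O}) (psi : O -> O).
Context (phiK : cancel phi psi) (psiK : cancel psi phi).

Definition inverse_morphism : O -> O := psi.

Fact inverse_morphism_linear : linear inverse_morphism.
Proof.
by move=> c f g; apply: (can_inj phiK); rewrite /inverse_morphism linearP /= !psiK.
Qed.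

Fact inverse_morphism_multiplicative : monoid_morphism inverse_morphism.
Proof.
split=> [|f g]; apply: (can_inj phiK); rewrite /inverse_morphism.
  by rewrite rmorph1 psiK.
by rewrite rmorphM /= !psiK.
Qed.

HB.instance Definition _ :=
  GRing.isLinear.Build K O O _ inverse_morphism inverse_morphism_linear.
HB.instance Definition _ :=
  GRing.isMonoidMorphism.Build O O inverse_morphism inverse_morphism_multiplicative.

Lemma inverse_lrmorphism : exists chi : {lrmorphism O -> O}, chi =1 psi.
Proof. by exists (inverse_morphism : {lrmorphism O -> O}). Qed.

End Inverse.

(** The inverse is local because the complement of the maximal ideal consists
    of units. *)
Lemma local_aut_inverse (phi : {lrmorphism O -> O}) : local_aut phi ->
  exists psi : {lrmorphism O -> O}, [/\ local_morphism psi, cancel phi psi & cancel psi phi].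
Proof.
move=> [[psi0 phiK psiK] lphi]; have [psi psiE] := inverse_lrmorphism phiK psiK.
exists psi; split=> [f /max_idealP f1|f|f]; rewrite ?psiE //.
rewrite -psiE; apply/max_idealP => a; rewrite ltnS leqn0 mdeg_eq0 => /eqP ->.
apply: contrapT => /eqP /cps_unitP u.
have := f1 0%MM; rewrite mdeg0 => /(_ isT) f0.
have /(congr1 (fun h : O => cps_val h 0%MM)) : f * phi (psi f)^-1 = 1.
  have {1}-> : f = phi (psi f) by rewrite psiE psiK.
  by rewrite -rmorphM mulrV // rmorph1.
rewrite cps_mulE cps_oneE mfps_oneE eqxx (order_geMr (d := 1)) ?mdeg0 //.
by move/eqP; rewrite eq_sym oner_eq0.
Qed.

(** By the chain rule the partial derivatives of [psi p] lie in the ideal generated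
    by the [psi (d_j p)], so [phi] carries [j(psi p)] into the ideal generated by the
    [d_j p], while the powers of the maximal ideal are preserved.  For contact
    equivalence [p] is a unit times the original series. *)
Lemma contains_order_transport (phi psi : {lrmorphism O -> O}) (g p : O)
    (S : set O) k :
  local_morphism psi -> cancel psi phi -> g = psi p ->
  (forall j, cps_deriv j p \in ideal_gen S) ->
  contains_order (jacobian_gens g) k -> contains_order S k.
Proof.
move=> lpsi psiK -> pS jk h hk.
have /ideal_gen_rangeP[c cE] := jk _ (local_morphism_order lpsi hk).
rewrite -(psiK h) cE rmorph_sum; apply: rpred_sum => i _.
rewrite rmorphM (chain_rule i p lpsi) rmorph_sum; apply: ideal_genM.
apply: rpred_sum => j _; rewrite rmorphM /= psiK mulrC.
exact: ideal_genM.
Qed.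

End Invariance.

(** * Finite determinacy *)

Section Determinacy.
Context (R : realType) (K : fieldType) (v : absolute_value R K) (n : nat).
Local Notation O := (cps v n).

Lemma scaled_tjurina_range e (f h : O) (S : set O) :
  h \in ideal_gen S ->
  (forall x, S x -> x \in ideal_gen (range (scaled_tjurina_gens e f))) ->
  exists c, h = \sum_j c j * scaled_tjurina_gens e f j.
Proof. by move=> hS ST; apply/ideal_gen_rangeP/(ideal_gen_sub ST hS). Qed.

Lemma jacobian_sub_scaled e (f x : O) : jacobian_gens f x ->
  x \in ideal_gen (range (scaled_tjurina_gens e f)).
Proof.
move=> [i _ <-]; apply: mem_ideal_gen; exists (lift ord0 i) => //.
by rewrite /scaled_tjurina_gens liftK.
Qed.

Lemma equivalent_of_close (e : K) (f g : O) k :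
  (forall h : O, order_ge k (cps_val h) ->
     exists c, h = \sum_j c j * scaled_tjurina_gens e f j) ->
  order_ge (2 * k + 2) (cps_val (f - g)) ->
  exists (w : O) (phi : {lrmorphism O -> O}),
    [/\ (1 + e *: w) \is a GRing.unit, local_aut phi & g = (1 + e *: w) * phi f].
Proof.
move=> H fg; have [|w [y [w1 yc y2 gE]]] := solve_unit_and_coordinates (g := g) H.
  by rewrite cps_subE; apply: order_ge_sym.
have [phi aphi phiE] := perturbed_aut yc y2.
exists w, phi; split=> //; last by apply: cps_inj; rewrite gE -phiE.
apply: cps_unitP; rewrite cps_addE mfps_addE cps_oneE mfps_oneE eqxx.
by rewrite cps_scaleE mfps_scaleE w1 ?mdeg0 // mulr0 addr0 oner_eq0.
Qed.

Lemma local_aut_sym (phi psi : {lrmorphism O -> O}) :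
  local_morphism psi -> cancel phi psi -> cancel psi phi -> local_aut psi.
Proof. by move=> lpsi phiK psiK; split=> //; exists phi. Qed.

(** If [f] is [d]-determined, it is equivalent to a perturbation with isolated
    critical point.  Conversely, an order of [f - g] beyond [2 k + 1] makes the
    terms quadratic in the coordinate change smaller than the linear ones. *)
Lemma right_determined_iff (f : O) :
  finitely_right_determined f <-> exists k, contains_order (jacobian_gens f) k.
Proof.
split=> [[d _ df]|[k fk]].
  have [g [fg [k gk]]] := isolated_perturbation f d; exists k.
  have [phi [aphi fE]] := df g (introT (ideal_exp_order _ _) fg).
  have [psi [lpsi phiK psiK]] := local_aut_inverse aphi.
  apply: (contains_order_transport (p := f) lpsi psiK _ _ gk); first by rewrite fE phiK.
  by move=> j; apply: mem_ideal_gen; exists j.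
exists (2 * k + 2)%N => [|g /ideal_exp_order fg]; first by rewrite addn2.
have H (h : O) : order_ge k (cps_val h) ->
    exists c, h = \sum_j c j * scaled_tjurina_gens 0 f j.
  by move/fk => hf; apply: scaled_tjurina_range hf _ => x; apply: jacobian_sub_scaled.
have [w [phi [_ aphi]]] := equivalent_of_close H (order_ge_le (leqnSn _) fg).
rewrite scale0r addr0 mul1r => gE.
have [psi [lpsi phiK psiK]] := local_aut_inverse aphi.
by exists psi; split; [apply: local_aut_sym psiK|rewrite gE phiK].
Qed.

Lemma contact_determined_iff (f : O) :
  finitely_contact_determined f <->
  exists k, contains_order ([set f] `|` jacobian_gens f)%classic k.
Proof.
set S := (_ `|` _)%classic.
have fS : f \in ideal_gen S by apply: mem_ideal_gen; left.
have jS j : cps_deriv j f \in ideal_gen S by apply: mem_ideal_gen; right; exists j.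
split=> [[d _ df]|[k fk]].
  have [g [fg [k gk]]] := isolated_perturbation f d; exists k.
  have [u [phi [uu aphi fE]]] := df g (introT (ideal_exp_order _ _) fg).
  have [psi [lpsi phiK psiK]] := local_aut_inverse aphi.
  apply: (contains_order_transport (p := u^-1 * f) lpsi psiK _ _ gk).
    by rewrite fE mulKr // phiK.
  by move=> j; rewrite cps_derivM; apply: rpredD; apply: ideal_genM.
exists (2 * k + 2)%N => [|g /ideal_exp_order fg]; first by rewrite addn2.
have H (h : O) : order_ge k (cps_val h) ->
    exists c, h = \sum_j c j * scaled_tjurina_gens 1 f j.
  move/fk => hf; apply: scaled_tjurina_range hf _ => x [->|]; last exact: jacobian_sub_scaled.
  apply: mem_ideal_gen; exists ord0 => //.
  by rewrite /scaled_tjurina_gens unlift_none scale1r.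
have [w [phi [uu aphi gE]]] := equivalent_of_close H (order_ge_le (leqnSn _) fg).
set u := 1 + _ in uu gE.
have [psi [lpsi phiK psiK]] := local_aut_inverse aphi.
exists (psi u^-1), psi; split.
- by apply: rmorph_unit; rewrite unitrV.
- exact: local_aut_sym psiK.
by rewrite gE -rmorphM mulKr //= phiK.
Qed.

End Determinacy.

Theorem theorem1p14 (R : realType) (K : fieldType) (v : absolute_value R K)
    (n : nat) (f : cps v n) (f_neq0 : f != 0) (fm : f \in @max_ideal R K v n) :
  (finitely_right_determined f <-> (milnor f < +oo)%E) /\
  (finitely_contact_determined f <-> (tjurina f < +oo)%E).
Proof.
split.
  exact: iff_trans (right_determined_iff f) (iff_sym (finite_codimension_order _)).
exact: iff_trans (contact_determined_iff f) (iff_sym (finite_codimension_order _)).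
Qed.
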